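(* Consider the energy-constrained scheduling problem with communication delays (defined in the context) with $m \ge n$ processors and a given $R \ge 1$. Let $\mu^*$ be the minimum makespan of a feasible schedule on $m$ processors that uses no preemption, migration, or recomputation and satisfies $c_{ij} \le R\, d_k$ for every edge $i \to j$ and every task $k$. Then one can construct in polynomial time a feasible schedule on $m$ processors, without preemption, migration, or recomputation, using at most $E$ energy, with makespan at most $\frac{2(R+1)}{3}\,\mu^*$.
   Context: Problem (with communication delays): a finite set $J$ of $n$ tasks; $m$ identical processors; a directed acyclic graph $G$ on $J$; a delay $c_{ij} \ge 0$ for each edge $i \to j$; for each task $j$ a convex, non-increasing energy function $e_j:[0,\infty)\to[0,\infty)$, assumed computable in polynomial time; an energy bound $E\ge 0$. A schedule without preemption, migration, or recomputation runs each task $j$ exactly once, in a single interval $[t_j, t_j + d_j]$ on a single processor $p_j$. It is feasible if: for every edge $i\to j$, $t_j \ge t_i + d_i$, and moreover $t_j \ge t_i + d_i + c_{ij}$ if $p_i \ne p_j$; each processor runs at most one task at any time; and $\sum_j e_j(d_j) \le E$. The makespan is $\max_j (t_j + d_j)$. Convention: convex programs are treated as solvable exactly in polynomial time (errors from finite-precision solution are ignored). *)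

(* Defs.v *)
From HB Require Import structures.
From mathcomp Require Import all_boot all_order all_algebra.
From mathcomp Require Import boolp classical_sets reals set_interval.
From mathcomp Require Import interval_inference convex.

Set Implicit Arguments.
Unset Strict Implicit.
Unset Printing Implicit Defensive.

Import Order.TTheory GRing.Theory Num.Theory.
Local Open Scope classical_set_scope.
Local Open Scope ring_scope.

(* The n tasks are the elements of 'I_n, the m processors those of 'I_m.
   [delay] is only meaningful on edges of [prec], and the energy functions
   only on [0, +oo[; no hypothesis or definition below depends on their
   values elsewhere. *)
Record instance (R : realType) (n m : nat) := Instance {
  prec : rel 'I_n;
  delay : 'I_n -> 'I_n -> R;
  energy : 'I_n -> R -> R;
  budget : R
}.

Definition acyclic (T : Type) (e : rel T) := forall c : seq T, cycle e c -> c = [::].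

Definition valid_energy (R : realType) (e : R -> R) :=
  [/\ convex_function (E := R^o) `[0, +oo[ e,
      (forall x y, 0 <= x -> x <= y -> e y <= e x) &
      (forall x, 0 <= x -> 0 <= e x)].

Definition valid_instance (R : realType) (n m : nat) (I : instance R n m) :=
  [/\ acyclic (prec I),
      (forall i j, prec I i j -> 0 <= delay I i j),
      (forall j, valid_energy (energy I j)) &
      0 <= budget I].

(* Task j runs once, during [start j, start j + dur j], on processor proc j:
   preemption, migration and recomputation are excluded by construction. *)
Record schedule (R : realType) (n m : nat) := Schedule {
  start : 'I_n -> R;
  dur : 'I_n -> R;
  proc : 'I_n -> 'I_m
}.

Definition feasible (R : realType) (n m : nat) (I : instance R n m)
    (S : schedule R n m) :=
  [/\ (forall j, 0 <= start S j /\ 0 <= dur S j),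
      (forall i j, prec I i j ->
         start S i + dur S i <= start S j /\
         (proc S i != proc S j ->
            start S i + dur S i + delay I i j <= start S j)),
      (forall i j, i != j -> proc S i = proc S j ->
         start S i + dur S i <= start S j \/
         start S j + dur S j <= start S i) &
      \sum_j energy I j (dur S j) <= budget I].

(* End times of feasible schedules are nonnegative, so the neutral element 0
   only matters when there is no task. *)
Definition makespan (R : realType) (n m : nat) (S : schedule R n m) : R :=
  \big[Num.max/0]_j (start S j + dur S j).

Definition delays_bounded (R : realType) (n m : nat) (I : instance R n m)
    (r : R) (S : schedule R n m) :=
  forall i j k, prec I i j -> delay I i j <= r * dur S k.

Definition min_makespan (R : realType) (n m : nat) (I : instance R n m)
    (r mu : R) :=
  (exists S, [/\ feasible I S, delays_bounded I r S & makespan S = mu]) /\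
  (forall S, feasible I S -> delays_bounded I r S -> mu <= makespan S).

(* Minimise \sum_i obj_i x_i over x >= 0 subject to, for every row k,
     \sum_i (lin_{k,i} x_i + wgt_{k,i} e_{fct i}(x_i)) <= rhs_k,
   the energy term of variable i being absent when fct i = None. *)
Record cprog (R : realType) (n : nat) := CProg {
  cp_nv : nat;
  cp_nc : nat;
  cp_obj : 'cV[R]_cp_nv;
  cp_lin : 'M[R]_(cp_nc, cp_nv);
  cp_wgt : 'M[R]_(cp_nc, cp_nv);
  cp_rhs : 'cV[R]_cp_nc;
  cp_fct : 'I_cp_nv -> option 'I_n
}.

Arguments cp_obj {R n} c.
Arguments cp_lin {R n} c.
Arguments cp_wgt {R n} c.
Arguments cp_rhs {R n} c.
Arguments cp_fct {R n} c.

(* With nonnegative weights and convex energy functions, all the constraints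
   are convex. *)
Definition cp_convex (R : realType) (n : nat) (P : cprog R n) :=
  forall k i, 0 <= cp_wgt P k i.

Definition cp_value (R : realType) (n : nat) (P : cprog R n)
    (x : 'cV[R]_(cp_nv P)) : R :=
  \sum_i cp_obj P i ord0 * x i ord0.
Arguments cp_value {R n} P x.

Definition cp_feasible (R : realType) (n : nat) (e : 'I_n -> R -> R)
    (P : cprog R n) (x : 'cV[R]_(cp_nv P)) :=
  (forall i, 0 <= x i ord0) /\
  (forall k,
     \sum_i (cp_lin P k i * x i ord0 +
             if cp_fct P i is Some j then cp_wgt P k i * e j (x i ord0) else 0)
     <= cp_rhs P k ord0).
Arguments cp_feasible {R n} e P x.

Definition cp_optimal (R : realType) (n : nat) (e : 'I_n -> R -> R)
    (P : cprog R n) (x : 'cV[R]_(cp_nv P)) :=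
  cp_feasible e P x /\
  forall y, cp_feasible e P y -> cp_value P x <= cp_value P y.
Arguments cp_optimal {R n} e P x.

Definition solver (R : realType) (n : nat) :=
  forall P : cprog R n, 'cV[R]_(cp_nv P).

(* Nothing is required of the answer when the optimum is not attained. *)
Definition exact_solver (R : realType) (n : nat) (e : 'I_n -> R -> R)
    (slv : solver R n) :=
  forall P : cprog R n, cp_convex P ->
    (exists x, cp_optimal e P x) -> cp_optimal e P (slv P).

(* Programs are finite syntactic objects acting on two-dimensional arrays of
   natural numbers and of reals; arrays are named by natural numbers. Natural
   numbers have no multiplication, so that T unit-cost steps only create numbers
   of O(T) bits; exact real arithmetic has unit cost. No real constant other
   than images of natural numbers can occur in a program. *)
Inductive nexpr :=
| NConst of nat
| NGet of nat & nexpr & nexpr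
| NAdd of nexpr & nexpr
| NSub of nexpr & nexpr.

Inductive rexpr :=
| RNat of nexpr
| RGet of nat & nexpr & nexpr
| RAdd of rexpr & rexpr
| RSub of rexpr & rexpr
| RMul of rexpr & rexpr
| RDiv of rexpr & rexpr
| REnergy of nexpr & rexpr.

Inductive bexpr :=
| BNLe of nexpr & nexpr
| BRLe of rexpr & rexpr
| BNot of bexpr
| BAnd of bexpr & bexpr.

(* [Solve nv nc obj lin wgt rhs fct x] submits the convex program with [nv]
   variables and [nc] constraints stored in the arrays [obj], [lin], [wgt],
   [rhs], [fct], and writes the answer into the real array [x]. *)
Inductive cmd :=
| Skip
| NSet of nat & nexpr & nexpr & nexpr
| RSet of nat & nexpr & nexpr & rexpr
| Seq of cmd & cmd
| If of bexpr & cmd & cmd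
| While of bexpr & cmd
| Solve of nexpr & nexpr & nat & nat & nat & nat & nat & nat.

Record store (R : realType) := Store {
  nmem : nat -> nat -> nat -> nat;
  rmem : nat -> nat -> nat -> R
}.

Definition upd (T : Type) (f : nat -> nat -> nat -> T) (a i j : nat) (v : T) :=
  fun a' i' j' => if [&& a' == a, i' == i & j' == j] then v else f a' i' j'.

Fixpoint neval (R : realType) (s : store R) (x : nexpr) : nat :=
  match x with
  | NConst k => k
  | NGet a i j => nmem s a (neval s i) (neval s j)
  | NAdd x1 x2 => (neval s x1 + neval s x2)%N
  | NSub x1 x2 => (neval s x1 - neval s x2)%N
  end.

(* Energy functions can be evaluated, but only at nonnegative arguments: any
   other argument is replaced by 0. *)
Fixpoint reval (R : realType) (n : nat) (e : 'I_n -> R -> R) (s : store R)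
    (x : rexpr) : R :=
  match x with
  | RNat y => (neval s y)%:R
  | RGet a i j => rmem s a (neval s i) (neval s j)
  | RAdd x1 x2 => reval e s x1 + reval e s x2
  | RSub x1 x2 => reval e s x1 - reval e s x2
  | RMul x1 x2 => reval e s x1 * reval e s x2
  | RDiv x1 x2 => reval e s x1 / reval e s x2
  | REnergy y x1 =>
      if insub (neval s y) is Some j then e j (Num.max 0 (reval e s x1)) else 0
  end.

Fixpoint beval (R : realType) (n : nat) (e : 'I_n -> R -> R) (s : store R)
    (b : bexpr) : bool :=
  match b with
  | BNLe x1 x2 => (neval s x1 <= neval s x2)%N
  | BRLe x1 x2 => reval e s x1 <= reval e s x2
  | BNot b1 => ~~ beval e s b1
  | BAnd b1 b2 => beval e s b1 && beval e s b2
  end.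

(* Vectors are stored in column 0 of an array; a value of [fct] that is not the
   index of a task stands for [None]. *)
Definition query (R : realType) (n : nat) (s : store R)
    (nv nc obj lin wgt rhs fct : nat) : cprog R n :=
  {| cp_nv := nv; cp_nc := nc;
     cp_obj := \col_i rmem s obj i 0;
     cp_lin := \matrix_(k, i) rmem s lin k i;
     cp_wgt := \matrix_(k, i) rmem s wgt k i;
     cp_rhs := \col_k rmem s rhs k 0;
     cp_fct := fun i => insub (nmem s fct i 0) |}.

Definition put_col (R : realType) (nv : nat) (s : store R) (a : nat)
    (x : 'cV[R]_nv) : store R :=
  Store (nmem s) (fun a' i j =>
    if (a' == a) && (j == 0) then
      if insub i is Some i' then x i' ord0 else rmem s a' i j
    else rmem s a' i j).

(* [exec e slv c s T s']: from store s, command c halts in T steps in store s'.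
   Expressions have constant size for a given program and cost O(1); a call to
   the solver is charged the size of its query. *)
Inductive exec (R : realType) (n : nat) (e : 'I_n -> R -> R) (slv : solver R n) :
    cmd -> store R -> nat -> store R -> Prop :=
| ExSkip s : exec e slv Skip s 1 s
| ExNSet s a i j x :
    exec e slv (NSet a i j x) s 1
      (Store (upd (nmem s) a (neval s i) (neval s j) (neval s x)) (rmem s))
| ExRSet s a i j x :
    exec e slv (RSet a i j x) s 1
      (Store (nmem s) (upd (rmem s) a (neval s i) (neval s j) (reval e s x)))
| ExSeq c1 c2 s1 s2 s3 T1 T2 :
    exec e slv c1 s1 T1 s2 -> exec e slv c2 s2 T2 s3 ->
    exec e slv (Seq c1 c2) s1 (T1 + T2) s3
| ExIf b c1 c2 s T s' :
    exec e slv (if beval e s b then c1 else c2) s T s' ->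
    exec e slv (If b c1 c2) s T.+1 s'
| ExWhileF b c s :
    beval e s b = false -> exec e slv (While b c) s 1 s
| ExWhileT b c s1 s2 s3 T1 T2 :
    beval e s1 b = true ->
    exec e slv c s1 T1 s2 -> exec e slv (While b c) s2 T2 s3 ->
    exec e slv (While b c) s1 (T1 + T2).+1 s3
| ExSolve nv nc obj lin wgt rhs fct x s :
    exec e slv (Solve nv nc obj lin wgt rhs fct x) s
      ((neval s nv).+1 * (neval s nc).+1)
      (put_col s x
         (slv (query n s (neval s nv) (neval s nc) obj lin wgt rhs fct))).

(* Input: n and m in cell (0, 0) of the natural arrays 0 and 1, the adjacency
   matrix in natural array 2, the delays in real array 0, E and r in cell (0, 0)
   of the real arrays 1 and 2; everything else is 0. The energy functions are
   accessed through [REnergy] and [Solve] only. *)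
Definition input (R : realType) (n m : nat) (I : instance R n m) (r : R) : store R :=
  Store
    (fun a i j => match a, i, j with
      | 0, 0, 0 => n
      | 1, 0, 0 => m
      | 2, _, _ => if (insub i, insub j) is (Some i', Some j')
                   then (prec I i' j' : nat) else 0%N
      | _, _, _ => 0%N
      end)
    (fun a i j => match a, i, j with
      | 0, _, _ => if (insub i, insub j) is (Some i', Some j')
                   then (if prec I i' j' then delay I i' j' else 0) else 0
      | 1, 0, 0 => budget I
      | 2, 0, 0 => r
      | _, _, _ => 0
      end).

(* Output: start times and durations in column 0 of the real arrays 3 and 4,
   processors in column 0 of the natural array 3. *)
Definition output (R : realType) (n m : nat) (s : store R) (S : schedule R n m) :=
  forall j : 'I_n,
    [/\ rmem s 3 j 0 = start S j, rmem s 4 j 0 = dur S j &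
        nmem s 3 j 0 = proc S j].

(* Since execution is deterministic and exact solvers exist, "some execution of
   the program, for every exact solver" has its intended meaning. *)
Lemma exec_det (R : realType) (n : nat) (e : 'I_n -> R -> R) (slv : solver R n)
    c s T1 s1 T2 s2 :
  exec e slv c s T1 s1 -> exec e slv c s T2 s2 -> T1 = T2 /\ s1 = s2.
Proof.
move=> H; elim: H T2 s2 => {c s T1 s1};
  intros; match goal with H : exec _ _ _ _ _ _ |- _ =>
    match goal with H' : exec _ _ _ _ _ _ |- _ => inversion H'; subst; clear H' end
  end.
all: repeat match goal with
  IH : forall T s, exec _ _ ?c ?s1 T s -> _, H : exec _ _ ?c ?s1 _ _ |- _ =>
    case: (IH _ _ H) => ? ?; subst; clear H
  end.
all: try by [].
all: by congruence.
Qed.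

Lemma exact_solver_exists (R : realType) (n : nat) (e : 'I_n -> R -> R) :
  exists slv : solver R n, exact_solver e slv.
Proof.
exists (fun P => xget 0 [set x | cp_optimal e P x]) => P _ Px.
exact: (@xgetPex _ 0 [set x | cp_optimal e P x]).
Qed.

(* Main.v *)
Require Import Defs.
From mathcomp Require Import all_boot all_order all_algebra.
From mathcomp Require Import boolp classical_sets reals set_interval.
From mathcomp Require Import interval_inference convex.
From mathcomp Require Import topology normedtype derive ring lra zify.

(** Shrink every delay c_ij to c_ij / r. In a schedule S with c_ij <= r d_k, each
task i then has at most one successor, and each task j at most one predecessor,
whose shrunk delay is avoided: a second one would have to run in between, for at
least c_ij / r. This gives a convex relaxation with variables t_j, d_j, the span M
and y_ij in [0, 1] (y_ij = 1 when the delay of i -> j is avoided), with constraints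
t_j >= t_i + d_i + (c_ij / r)(1 - y_ij) >= t_i + d_i and unit row and column sums of
y. The edges with y_ij > 1/2 form disjoint chains; run each chain on its own
processor, keep the durations, and multiply the start times by 2(r + 1)/3. An edge
with y_ij <= 1/2 has t_j - t_i >= d_i + c_ij / (2r), and since c_ij <= r d_i the
dilated gap is at least d_i + c_ij. *)

(** The threshold 1/2 serves both purposes: two entries above 1/2 cannot share a row or column of
    sum at most 1, and an entry at most 1/2 leaves at least half of the shrunk delay in the gap.
    With q = c_ij / r, the dilation factor L must satisfy L (d_i + q / 2) >= d_i + r q whenever 0 <=
    q <= d_i; the worst case q = d_i gives L = 2 (r + 1) / 3. Since r >= 1, a shrunk delay never
    exceeds the true one, so an edge that avoids it joins tasks of one processor.

    The bound q <= d_k does not follow from feasibility; the convex program imposes it on all tasks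
    through an extra variable lying between all the c_ij / r and all the d_k.

    The obstacle is attainment: an exact solver is only bound to answer correctly when the optimum
    is attained, and an energy function that jumps at 0 can make the feasible set non-closed. The
    extra variable also helps here, since a single positive delay keeps every duration away from
    0. *)

Set Implicit Arguments.
Unset Strict Implicit.
Unset Printing Implicit Defensive.

Import Order.TTheory GRing.Theory Num.Theory.
Import numFieldNormedType.Exports.
Local Open Scope ring_scope.

(** * Attainment of the optimum *)

(** The point x is the convex combination of 0 and y with weight (y - x) / y on 0. The chord gives x
    (e x - e y) <= (y - x) e 0, and x >= delta. *)
Lemma convex_nonincreasing_lipschitz (R : realType) (e : R -> R) (delta x y : R) :
  valid_energy e -> 0 < delta -> delta <= x -> x <= y ->
  0 <= e x - e y <= e 0 / delta * (y - x).
Proof.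
move=> [cvx dec pos] d0 dx xy.
have x0 : 0 < x by lra.
have y0 : 0 < y by lra.
rewrite subr_ge0 dec ?(ltW x0)//=.
have s0 : 0 <= (y - x) / y by rewrite divr_ge0 ?subr_ge0// ltW.
have s1 : (y - x) / y <= 1 by rewrite ler_pdivrMr//; lra.
have in0 (z : R) : 0 <= z -> (z : R^o) \in `[0, +oo[%classic.
  by move=> z0; rewrite inE/= in_itv/= z0.
pose s := (y - x) / y.
have : e (s * 0 + (1 - s) * y) <= s * e 0 + (1 - s) * e y.
  exact: cvx (Itv01 s0 s1) 0 y (in0 _ (lexx 0)) (in0 _ (ltW y0)).
rewrite /s.
have -> : (y - x) / y * 0 + (1 - (y - x) / y) * y = x by field; rewrite gt_eqF.
move=> H; have e0 := pos 0 (lexx 0); have ex0 := pos x (ltW x0).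
have {}H : y * e x <= (y - x) * e 0 + x * e y.
  rewrite -(ler_pM2l y0) in H; apply: le_trans H _; rewrite le_eqVlt; apply/orP; left.
  by apply/eqP; field; rewrite gt_eqF.
have H2 : x * (e x - e y) <= (y - x) * e 0 by nra.
rewrite mulrAC ler_pdivlMr// [e 0 * _]mulrC.
apply: le_trans H2; rewrite mulrC ler_wpM2r// subr_ge0 dec//.
exact: ltW.
Qed.

(** Clamping the argument at delta hides a possible jump at 0: the clamped function is Lipschitz
    with constant e 0 / delta. *)
Lemma valid_energy_max_continuous (R : realType) (e : R -> R) (delta : R) :
  valid_energy e -> 0 < delta -> continuous (fun x => e (Num.max delta x)).
Proof.
move=> ve d0 x; have [_ _ pos] := ve.
have L0 : 0 <= e 0 / delta by apply: divr_ge0; [exact: pos (lexx 0)|exact: ltW].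
have lip y z : y <= z ->
    `|e (Num.max delta y) - e (Num.max delta z)| <= e 0 / delta * (z - y).
  move=> yz.
  have dy : delta <= Num.max delta y by rewrite le_max lexx.
  have myz : Num.max delta y <= Num.max delta z by rewrite ge_max !le_max lexx yz/= orbT.
  have /andP[h0 h1] := convex_nonincreasing_lipschitz ve d0 dy myz.
  rewrite ger0_norm//; apply: le_trans h1 _; rewrite ler_wpM2l//.
  by case: (leP delta y); case: (leP delta z) => *; lra.
apply/cvgrPdist_lt => eps eps0; near=> y.
(* Adding 1 keeps the divisor positive when e 0 = 0. *)
have : `|x - y| < eps / (e 0 / delta + 1).
  near: y; apply: (@cvgr_dist_lt _ _ _ (nbhs x) _ id x); first exact: cvg_id.
  by rewrite divr_gt0// ltr_wpDl.
rewrite ltr_pdivlMr ?ltr_wpDl// => H.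
apply: le_lt_trans H; have [xy|/ltW yx] := leP x y.
  apply: le_trans (lip _ _ xy) _; rewrite distrC ger0_norm ?subr_ge0//; nra.
rewrite distrC; apply: le_trans (lip _ _ yx) _; rewrite ger0_norm ?subr_ge0//; nra.
Unshelve. all: by end_near. Qed.

Lemma sum_continuous (R : realType) (T : topologicalType) (I : Type)
    (s : seq I) (F : I -> T -> R) :
  (forall i, continuous (F i)) -> continuous (fun x => \sum_(i <- s) F i x).
Proof.
move=> cF; elim: s => [|i s IH].
  rewrite (_ : (fun x => _) = (fun=> 0)); first by move=> x; exact: cvg_cst.
  by apply/funext => x; rewrite big_nil.
rewrite (_ : (fun x => _) = (fun x => F i x + \sum_(j <- s) F j x)).
  by move=> x; apply: cvgD; [exact: cF|exact: IH].
by apply/funext => x; rewrite big_cons.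
Qed.

Lemma cst_mul_continuous (R : realType) (T : topologicalType) (c : R) (f : T -> R) :
  continuous f -> continuous (fun x => c * f x).
Proof. by move=> cf x; apply: cvgM; [exact: cvg_cst|exact: cf]. Qed.

Lemma add_fun_continuous (R : realType) (T : topologicalType) (f g : T -> R) :
  continuous f -> continuous g -> continuous (fun x => f x + g x).
Proof. by move=> cf cg x; apply: cvgD; [exact: cf|exact: cg]. Qed.

Lemma real_comp_continuous (R : realType) (T : topologicalType) (g : R -> R) (f : T -> R) :
  continuous g -> continuous f -> continuous (fun x => g (f x)).
Proof. by move=> cg cf x; apply: continuous_comp; [exact: cf|exact: cg]. Qed.

Lemma closed_le_cst (R : realType) (T : topologicalType) (f : T -> R) (b : R) :
  continuous f -> closed [set x | f x <= b]%classic.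
Proof.
move=> cf; apply: (@preimage_closed _ _ f [set y | y <= b]%classic) => [x _|].
  exact: cf.
exact: closed_le.
Qed.

(* A convex energy may jump at 0, so attainment needs the arguments of the
   energies to stay away from 0. *)
Lemma cp_optimal_exists (R : realType) (n : nat) (e : 'I_n -> R -> R)
    (P : cprog R n) (delta B : R) (x0 : 'cV[R]_(cp_nv P)) :
  (forall j, valid_energy (e j)) -> 0 < delta -> cp_feasible e P x0 ->
  (forall x, cp_feasible e P x -> cp_value P x <= cp_value P x0 ->
     (forall i, x i ord0 <= B) /\
     (forall k i, cp_fct P i -> cp_wgt P k i != 0 -> delta <= x i ord0)) ->
  exists x, cp_optimal e P x.
Proof.
move=> ve d0 fx0 bnd.
pose g k (v : 'rV[R]_(cp_nv P)) := \sum_i (cp_lin P k i * v ord0 i +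
  if cp_fct P i is Some j then cp_wgt P k i * e j (Num.max delta (v ord0 i)) else 0).
pose f (v : 'rV[R]_(cp_nv P)) : R := \sum_i cp_obj P i ord0 * v ord0 i.
(* The closed condition [h q v <= - delta] keeps away from 0 exactly the arguments whose energy has
   a nonzero weight, and is trivial for the others. Where it holds, the clamped rows [g] agree with
   the original ones. *)
pose h (q : 'I_(cp_nc P) * 'I_(cp_nv P)) (v : 'rV[R]_(cp_nv P)) : R :=
  if cp_fct P q.2 && (cp_wgt P q.1 q.2 != 0) then - v ord0 q.2 else - delta.
have cc i : continuous (fun v : 'rV[R]_(cp_nv P) => v ord0 i : R).
  exact: coord_continuous.
have ccst (c : R) : continuous (fun _ : 'rV[R]_(cp_nv P) => c).
  exact: cst_continuous.
have cf : continuous f.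
  by apply: sum_continuous => i; exact: cst_mul_continuous.
have cg k : continuous (g k).
  apply: sum_continuous => i; apply: add_fun_continuous.
    exact: cst_mul_continuous.
  case: cp_fct => [j|]; last exact: ccst.
  apply/cst_mul_continuous/(@real_comp_continuous _ _ (fun x => e j (Num.max delta x))).
    exact: valid_energy_max_continuous.
  exact: cc.
have ch q : continuous (h q).
  rewrite /h; case: (_ && _); last exact: ccst.
  by apply: (@real_comp_continuous _ _ -%R) => // x; exact: opp_continuous.
pose box := [set v : 'rV[R]_(cp_nv P) | forall i, `[0, B]%classic (v ord0 i)]%classic.
pose C := ([set v | f v <= cp_value P x0] `&`
  ((\bigcap_(k in setT) [set v | g k v <= cp_rhs P k ord0]) `&`
   (\bigcap_(q in setT) [set v | h q v <= - delta])))%classic.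
have clC : closed C.
  have cr := closed_bigI (fun k (_ : setT k) => closed_le_cst (b := cp_rhs P k ord0) (cg k)).
  have cd := closed_bigI (fun q (_ : setT q) => closed_le_cst (b := - delta) (ch q)).
  exact (closedI (closed_le_cst cf) (closedI cr cd)).
have cbox : compact box.
  exact (@rV_compact _ _ (fun=> `[0, B]%classic) (fun=> @segment_compact R 0 B)).
have fC x : cp_feasible e P x -> cp_value P x <= cp_value P x0 -> (box `&` C)%classic x^T.
  move=> fx vx; have [xB xd] := bnd x fx vx; have [xpos xrow] := fx.
  split; first by move=> i; rewrite /= mxE in_itv/= xpos xB.
  split; first by rewrite /= /f; under eq_bigr do rewrite mxE.
  split=> [k _|[k i] _] /=; last first.
    rewrite /h /= mxE; case: ifP => // /andP[h1 h2].
    by rewrite lerN2 (xd k i).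
  apply: le_trans (xrow k); rewrite le_eqVlt; apply/orP; left; apply/eqP.
  apply: eq_bigr => i _; rewrite mxE; case E: cp_fct => [j|//].
  have [->|w0] := eqVneq (cp_wgt P k i) 0; first by rewrite !mul0r.
  by rewrite max_r// (xd k i)// E.
have [c cC cmin] := @compact_EVT_min _ R f (box `&` C)%classic
  (ex_intro _ x0^T (fC x0 fx0 (lexx _)))
  (subclosed_compact (closedI (compact_closed (@norm_hausdorff _ _) cbox) clC) cbox
    (@subIsetl _ _ _))
  (continuous_subspaceT cf).
rewrite inE in cC; case: cC => cbx [cv [cr ce]].
have fc : cp_feasible e P c^T.
  split=> [i|k]; first by have := cbx i; rewrite /= mxE in_itv/= => /andP[].
  apply: le_trans (cr k I); rewrite le_eqVlt; apply/orP; left; apply/eqP.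
  apply: eq_bigr => i _; rewrite mxE; case E: cp_fct => [j|//].
  have [->|w0] := eqVneq (cp_wgt P k i) 0; first by rewrite !mul0r.
  have := ce (k, i) I; rewrite /= /h /= E w0 /= lerN2 => ?.
  by rewrite max_r.
have vf v : cp_value P v^T = f v by apply: eq_bigr => i _; rewrite mxE.
exists c^T; split=> // y fy; rewrite vf.
(* A point worse than [x0] lies outside [C], but the minimum over [C] is at most the value at
   [x0]. *)
have [yx|/ltW xy] := leP (cp_value P y) (cp_value P x0).
  have := cmin y^T (mem_set (fC y fy yx)); rewrite -(vf y^T) trmxK; exact.
exact: le_trans cv xy.
Qed.

(** * A total-correctness logic *)

(** The step count is only bounded above, so that both branches of a conditional can share one
    bound. *)
Definition runs (R : realType) (n : nat) (e : 'I_n -> R -> R) (slv : solver R n)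
    (c : cmd) (s : store R) (T : nat) (Q : store R -> Prop) :=
  exists T' s', [/\ exec e slv c s T' s', (T' <= T)%N & Q s'].

Definition setn (R : realType) (s : store R) a i j x :=
  Store (upd (nmem s) a i j x) (rmem s).
Definition setr (R : realType) (s : store R) a i j x :=
  Store (nmem s) (upd (rmem s) a i j x).

Definition nvar (v : nat) := NGet v (NConst 0) (NConst 0).
Definition nvar_set (v : nat) (x : nexpr) := NSet v (NConst 0) (NConst 0) x.

(* The bound of every loop is n, which cell (0, 0) of natural array 0 holds. *)
Definition for_ (v : nat) (c : cmd) :=
  Seq (nvar_set v (NConst 0))
    (While (BNot (BNLe (nvar 0) (nvar v)))
       (Seq c (nvar_set v (NAdd (nvar v) (NConst 1))))).

Lemma upd_same (T : Type) (f : nat -> nat -> nat -> T) a i j x :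
  upd f a i j x a i j = x.
Proof. by rewrite /upd !eqxx. Qed.

Section Runs.
Variables (R : realType) (n : nat) (e : 'I_n -> R -> R) (slv : solver R n).
Local Notation runs := (runs e slv).

Lemma runs_weaken c s T T2 (Q Q2 : store R -> Prop) :
  runs c s T Q -> (T <= T2)%N -> (forall s', Q s' -> Q2 s') -> runs c s T2 Q2.
Proof.
move=> [T' [s' [h1 h2 h3]]] TT QQ; exists T', s'; split=> //; last exact: QQ.
exact: leq_trans h2 TT.
Qed.

Lemma runs_nset s a i j x i' j' x' Q :
  neval s i = i' -> neval s j = j' -> neval s x = x' ->
  Q (setn s a i' j' x') -> runs (NSet a i j x) s 1 Q.
Proof. by move=> <- <- <- q; eexists _, _; split; [exact: ExNSet| |exact: q]. Qed.

Lemma runs_rset s a i j x i' j' x' Q :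
  neval s i = i' -> neval s j = j' -> reval e s x = x' ->
  Q (setr s a i' j' x') -> runs (RSet a i j x) s 1 Q.
Proof. by move=> <- <- <- q; eexists _, _; split; [exact: ExRSet| |exact: q]. Qed.

Lemma runs_seq c1 c2 s T1 T2 (Q1 Q : store R -> Prop) :
  runs c1 s T1 Q1 -> (forall s', Q1 s' -> runs c2 s' T2 Q) ->
  runs (Seq c1 c2) s (T1 + T2) Q.
Proof.
move=> [T' [s' [h1 h2 h3]]] /(_ s' h3)[T'' [s'' [k1 k2 k3]]].
exists (T' + T'')%N, s''; split=> //; first exact: ExSeq h1 k1.
exact: leq_add.
Qed.

Lemma runs_if b c1 c2 s T Q :
  (beval e s b -> runs c1 s T Q) -> (~~ beval e s b -> runs c2 s T Q) ->
  runs (If b c1 c2) s T.+1 Q.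
Proof.
move=> H1 H2.
have [T' [s' [h1 h2 h3]]] : runs (if beval e s b then c1 else c2) s T Q.
  by case: (beval e s b) H1 H2 => [H _|_ H]; exact: H.
by exists T'.+1, s'; split=> //; exact: ExIf h1.
Qed.

Lemma runs_skip s (Q : store R -> Prop) : Q s -> runs Skip s 1 Q.
Proof. by move=> q; exists 1%N, s; split=> //; exact: ExSkip. Qed.

(** An iteration costs the body, the increment and the test, hence [Tb + 2]; the last 2 pays for the
    initialisation and the failing test. The invariant is asked of the store after the increment, so
    it may speak of the counter itself. *)
Lemma runs_for v c s Tb (Inv : nat -> store R -> Prop) :
  (forall i s, Inv i s -> nmem s 0 0 0 = n) ->
  Inv 0 (setn s v 0 0 0) ->
  (forall i s, (i < n)%N -> nmem s v 0 0 = i -> Inv i s ->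
     runs c s Tb (fun s' => nmem s' v 0 0 = i /\ Inv i.+1 (setn s' v 0 0 i.+1))) ->
  runs (for_ v c) s (n * (Tb + 2) + 2) (Inv n).
Proof.
move=> In I0 Istep.
suff H m : forall i s, (i + m = n)%N -> nmem s v 0 0 = i -> Inv i s ->
    runs (While (BNot (BNLe (nvar 0) (nvar v)))
       (Seq c (nvar_set v (NAdd (nvar v) (NConst 1))))) s (m * (Tb + 2) + 1) (Inv n).
  apply: (@runs_weaken _ _ (1 + (n * (Tb + 2) + 1)) _ (Inv n)); [|lia|by []].
  apply: runs_seq (_ : runs _ _ _ (fun s' => s' = setn s v 0 0 0)) _.
    exact: (runs_nset (erefl _) (erefl _) (erefl _)).
  by move=> _ ->; apply: (H n 0) => //; exact: upd_same.
elim: m => [|m IH] i s1 im vi Is.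
  exists 1%N, s1; split=> //; last by rewrite -im addn0.
  by apply: ExWhileF; rewrite /= (In _ _ Is) vi -im addn0 leqnn.
have lin : (i < n)%N by lia.
have [T1 [s2 [h1 h2 [vs2 I2]]]] := Istep i s1 lin vi Is.
have [T2 [s3 [k1 k2 k3]]] : runs _ (setn s2 v 0 0 i.+1) _ _ := IH i.+1 (setn s2 v 0 0 i.+1)
   ltac:(lia) (upd_same _ _ _ _ _) I2.
exists (T1 + 1 + T2).+1, s3; split=> //; last by rewrite mulSn; lia.
apply: ExWhileT k1; first by rewrite /= (In _ _ Is) vi -ltnNge.
apply: ExSeq h1 _.
have := @ExNSet R n e slv s2 v (NConst 0) (NConst 0) (NAdd (nvar v) (NConst 1)).
by rewrite /= vs2 addn1.
Qed.

End Runs.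

(** * The program *)

(* Task i has start time variable i and duration variable n + i; the makespan
   bound is variable 2n and the lower bound on durations variable 2n + 1. The
   variable y_ij at 2n + 2 + n i + j measures how much the edge i -> j avoids its
   delay. Natural arrays: 4 holds 2n + 2 + n i in row i, 5 the energy indices,
   6 to 8 loop counters, 9 the current row number of the convex program, 10 and
   11 temporaries. Real arrays: 5 to 8 hold the objective, linear part, weights
   and right-hand sides of the convex program, 9 its solution. *)
Definition task_i := nvar 6.
Definition task_j := nvar 7.
Definition task_k := nvar 8.
Definition idx_dur i := NAdd (nvar 0) i.
Definition idx_span := NAdd (nvar 0) (nvar 0).
Definition idx_low := NAdd idx_span (NConst 1).
Definition idx_loc i j := NAdd (NGet 4 i (NConst 0)) j.
Definition rconst k := RNat (NConst k).
Definition ropp x := RSub (rconst 0) x.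

(** Natural expressions have no product, so the offsets 2n + 2 + n i are accumulated by additions.
    The ones written in row 0 of the weights turn that row into the energy constraint. *)
Definition program_layout :=
  Seq (NSet 4 (NConst 0) (NConst 0) (NAdd idx_span (NConst 2)))
  (for_ 6
    (Seq (NSet 4 (NAdd task_i (NConst 1)) (NConst 0)
            (NAdd (NGet 4 task_i (NConst 0)) (nvar 0)))
    (Seq (NSet 5 (idx_dur task_i) (NConst 0) task_i)
         (RSet 7 (NConst 0) (idx_dur task_i) (rconst 1))))).

Definition program_header :=
  Seq (RSet 5 idx_span (NConst 0) (rconst 1))
  (Seq (RSet 8 (NConst 0) (NConst 0) (RGet 1 (NConst 0) (NConst 0)))
       (nvar_set 9 (NConst 1))).

(** Accumulating instead of overwriting stays correct when two terms of a row hit the same variable,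
    as in an edge row with i = j. *)
Definition add_term i x :=
  RSet 6 (nvar 9) i (RAdd (RGet 6 (nvar 9) i) x).
Definition end_row b :=
  Seq (RSet 8 (nvar 9) (NConst 0) b) (nvar_set 9 (NAdd (nvar 9) (NConst 1))).

Definition edge_ij := RNat (NGet 2 task_i task_j).
Definition reduced_delay_ij :=
  RDiv (RGet 0 task_i task_j) (RGet 2 (NConst 0) (NConst 0)).

Definition span_row :=
  Seq (add_term task_i (rconst 1))
  (Seq (add_term (idx_dur task_i) (rconst 1))
  (Seq (add_term idx_span (ropp (rconst 1)))
       (end_row (rconst 0)))).
(** Together with [delay_row], this expresses c_ij / r <= d_k for all edges and tasks with
    quadratically many rows instead of cubically many. *)
Definition low_row :=
  Seq (add_term idx_low (rconst 1))
  (Seq (add_term (idx_dur task_i) (ropp (rconst 1)))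
       (end_row (rconst 0))).
Definition out_row :=
  Seq (for_ 7 (add_term (idx_loc task_i task_j) (rconst 1))) (end_row (rconst 1)).
Definition in_row :=
  Seq (for_ 7 (add_term (idx_loc task_j task_i) (rconst 1))) (end_row (rconst 1)).
(** Emitted for every ordered pair: on a non-edge, [edge_ij] and the stored delay are both 0 and the
    row reads 0 <= 0. The row numbering thus does not depend on the graph. *)
Definition edge_row :=
  Seq (add_term task_i edge_ij)
  (Seq (add_term (idx_dur task_i) edge_ij)
  (Seq (add_term task_j (ropp edge_ij))
  (Seq (add_term (idx_loc task_i task_j) (ropp reduced_delay_ij))
       (end_row (ropp reduced_delay_ij))))).
Definition delay_row :=
  Seq (add_term idx_low (ropp (rconst 1))) (end_row (ropp reduced_delay_ij)).

Definition program_rows :=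
  for_ 6 (Seq span_row (Seq low_row (Seq out_row (Seq in_row
            (for_ 7 (Seq edge_row delay_row)))))).

(** Entry n of the offset table is 2n + 2 + n * n, the number of variables. The two occurrences of 5
    name different arrays: the real one for the objective, the natural one for the energy
    indices. *)
Definition solve_program := Solve (NGet 4 (nvar 0) (NConst 0)) (nvar 9) 5 6 7 8 5 9.

Definition ratio :=
  RDiv (RMul (rconst 2) (RAdd (RGet 2 (NConst 0) (NConst 0)) (rconst 1))) (rconst 3).

Definition round_solution :=
  for_ 6
    (Seq (RSet 3 task_i (NConst 0) (RMul ratio (RGet 9 task_i (NConst 0))))
    (Seq (RSet 4 task_i (NConst 0) (RGet 9 (idx_dur task_i) (NConst 0)))
         (NSet 3 task_i (NConst 0) task_i))).

Definition is_local :=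
  let y := RGet 9 (idx_loc task_i task_j) (NConst 0) in
  BAnd (BNLe (NConst 1) (NGet 2 task_i task_j)) (BNot (BRLe (RAdd y y) (rconst 1))).

Definition relabel :=
  for_ 8
    (If (BAnd (BNLe (NGet 3 task_k (NConst 0)) (nvar 11))
              (BNLe (nvar 11) (NGet 3 task_k (NConst 0))))
        (NSet 3 task_k (NConst 0) (nvar 10)) Skip).

(** Union of classes by relabelling, starting from singletons. Both labels are first copied to cells
    10 and 11, because [relabel] overwrites the entries they come from. *)
Definition merge_chains :=
  for_ 6 (for_ 7
    (If is_local
       (Seq (nvar_set 10 (NGet 3 task_i (NConst 0)))
       (Seq (nvar_set 11 (NGet 3 task_j (NConst 0)))
            relabel))
       Skip)).

Definition scheduler :=
  Seq program_layout (Seq program_header (Seq program_rows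
    (Seq solve_program (Seq round_solution merge_chains)))).

(** * Correctness of the program *)

(** Nested so that [big_split_ord] splits off the start times, then the durations. *)
Definition nvars (n : nat) := (n + (n + (2 + n * n)))%N.
Definition loc_index (n i j : nat) := (n + n + 2 + i * n + j)%N.

Section Build.
Variables (R : realType) (n : nat) (e : 'I_n -> R -> R) (slv : solver R n).
Variables (adj : nat -> nat -> nat) (del : nat -> nat -> R) (E r : R).
Local Notation runs := (runs e slv).

Definition env (s : store R) :=
  [/\ nmem s 0 0 0 = n, nmem s 2 = adj, rmem s 0 = del, rmem s 1 0 0 = E
    & rmem s 2 0 0 = r].

Definition layout_upto (m : nat) (s : store R) :=
  [/\ (forall i, (i <= m)%N -> nmem s 4 i 0 = (n + n + 2 + i * n)%N),
      (forall i, (i < m)%N -> nmem s 5 (n + i)%N 0 = i) &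
      (forall k i, rmem s 7 k i = if (k == 0%N) && (n <= i < n + m)%N then 1 else 0)].

Lemma loc_index_lt i j : (i < n)%N -> (j < n)%N -> (loc_index n i j < nvars n)%N.
Proof. by rewrite /loc_index /nvars; nia. Qed.

Lemma runs_layout s : env s -> (forall k i, rmem s 7 k i = 0) ->
  runs program_layout s (1 + (n * (1 + (1 + 1) + 2) + 2)) (fun s' =>
    [/\ env s', layout_upto n s',
    rmem s' 5 = rmem s 5, rmem s' 6 = rmem s 6 & rmem s' 8 = rmem s 8]).
Proof.
move=> env_s w0; have [n_s _ _ _ _] := env_s.
apply: runs_seq (_ : runs _ _ _ (fun s' => s' = setn s 4 0 0 (n + n + 2)%N)) _.
  by apply: runs_nset; [..|reflexivity] => //=; rewrite n_s.
move=> _ ->.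
apply: (runs_for (Inv := fun m s' => [/\ env s', layout_upto m s',
    rmem s' 5 = rmem s 5, rmem s' 6 = rmem s 6 & rmem s' 8 = rmem s 8])).
- by move=> i s' [[]].
- split=> //; split=> [i|//|k i]; last by rewrite [LHS]w0; case: ifP => //; lia.
  by rewrite leqn0 => /eqP ->; rewrite mul0n addn0.
move=> i s' lin vi [env_s' [base fct wgt] m5 m6 m8].
have n_s' : nmem s' 0 0 0 = n by case: env_s'.
have vi' : neval s' task_i = i by [].
have b_i := base i (leqnn i).
set s1 := setn s' 4 i.+1 0 (n + n + 2 + i.+1 * n).
apply: runs_seq (_ : runs _ _ _ (fun t => t = s1)) _.
  apply: runs_nset; [..|reflexivity] => //=; first by rewrite vi addn1.
  by rewrite vi n_s' b_i mulSn addnAC addnA.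
move=> _ ->.
set s2 := setn s1 5 (n + i) 0 i.
apply: runs_seq (_ : runs _ _ _ (fun t => t = s2)) _.
  apply: runs_nset; [exact: (f_equal2 addn n_s' vi)|by []|exact: vi|reflexivity].
move=> _ ->; apply: runs_rset; [by []|exact: (f_equal2 addn n_s' vi)|by []|].
split=> //; split=> //; split=> [k|k|k l].
- rewrite leq_eqVlt => /orP[/eqP ->|]; first exact: upd_same.
  rewrite ltnS => ki; have := base k ki; rewrite /= /upd /=.
  by case: eqP => // ?; lia.
- rewrite ltnS leq_eqVlt => /orP[/eqP ->|ki]; first exact: upd_same.
  have := fct k ki; rewrite /= /upd /=.
  by case: eqP => // ?; lia.
- rewrite /= /upd /= wgt; case: k => [|k] //=.
  case: eqP => [->|?]; first by rewrite leq_addr ltn_add2l ltnSn.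
  by congr (if _ then _ else _); lia.
Qed.

(** * Construction of the rows of the convex program *)

Definition header_ok (s : store R) :=
  forall i, rmem s 5 i 0 = if i == (n + n)%N then 1 else 0.

Definition row_value (s : store R) (k : nat) (X : nat -> R) : R :=
  \sum_(i < nvars n) rmem s 6 k i * X i.

(* The rows 1 to nc - 1 of the convex program are complete and amount to P, and
   row nc under construction has linear part L; row 0 is the energy constraint. *)
Definition building (s : store R) (nc : nat) (P : (nat -> R) -> Prop)
    (L : (nat -> R) -> R) :=
  [/\ (0 < nc)%N /\ nmem s 9 0 0 = nc,
      (forall i, rmem s 6 0 i = 0) /\ rmem s 8 0 0 = E,
      (forall k i, (nc < k)%N -> rmem s 6 k i = 0),
      (forall X, row_value s nc X = L X) &
      (forall X, (forall k, (0 < k < nc)%N -> row_value s k X <= rmem s 8 k 0) <-> P X)].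

Lemma row_value_setr s k i a k' X : (i < nvars n)%N ->
  row_value (setr s 6 k i (rmem s 6 k i + a)) k' X =
  row_value s k' X + if k' == k then a * X i else 0.
Proof.
move=> lin; rewrite /row_value (bigD1 (Ordinal lin))//= [in RHS](bigD1 (Ordinal lin))//=.
rewrite /upd /= eqxx andbT [RHS]addrAC; congr (_ + _).
  by case: eqP => [->|_]; rewrite ?mulrDl ?addr0.
by apply: eq_bigr => j; rewrite -val_eqE /= => /negPf ->; rewrite andbF.
Qed.

Lemma building_term s nc P L i a : (i < nvars n)%N -> building s nc P L ->
  building (setr s 6 nc i (rmem s 6 nc i + a)) nc P (fun X => L X + a * X i).
Proof.
move=> lin [[nc0 nc_s] [z0 E_s] fresh Lnc rowsP]; split=> //.
- split=> // j; rewrite /= /upd /=; case: ifP => [/andP[/eqP ? _]|_]; last exact: z0.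
  by lia.
- move=> k j nck; rewrite /= /upd /= gtn_eqF//=; exact: fresh.
- by move=> X; rewrite row_value_setr// eqxx Lnc.
move=> X; rewrite -rowsP; split=> H k /[dup] /andP[_ kn] /H;
  by rewrite row_value_setr// ltn_eqF// addr0.
Qed.

Lemma building_end s nc P L b : building s nc P L ->
  building (setn (setr s 8 nc 0 b) 9 0 0 nc.+1) nc.+1
    (fun X => P X /\ L X <= b) (fun=> 0).
Proof.
move=> [[nc0 nc_s] [z0 E_s] fresh Lnc rowsP]; split=> //.
- by split=> //; rewrite /= /upd /=; case: eqP => // ?; lia.
- by move=> k i nck; apply: fresh; exact: ltnW.
- by move=> X; rewrite /row_value big1// => i _; rewrite [rmem _ _ _ _]fresh ?mul0r.
move=> X.
have rE k : row_value (setn (setr s 8 nc 0 b) 9 0 0 nc.+1) k X = row_value s k X by [].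
split=> [H|[/rowsP HP Lb] k]; last first.
  rewrite ltnS [(k <= nc)%N]leq_eqVlt rE /= /upd /= eqxx andbT.
  case: eqP => [-> _|_ /= /HP //].
  by rewrite Lnc.
split.
  apply/rowsP => k /andP[k0 kn]; have := H k; rewrite k0 ltnS ltnW// => /(_ isT).
  by rewrite rE /= /upd /= ltn_eqF.
have := H nc; rewrite nc0 ltnSn => /(_ isT); rewrite rE Lnc /= /upd /= eqxx.
by [].
Qed.

Lemma building_ext s nc P Q L : building s nc P L -> (forall X, P X <-> Q X) ->
  building s nc Q L.
Proof.
by move=> [h1 h2 h3 h4 h5] PQ; split=> // X; rewrite h5.
Qed.

(** [F] is a frame: any property insensitive to writes into the linear part, such as [ctx i] or
    [ctx2 i j]. *)
Lemma runs_add_term (F : store R -> Prop) s nc P L x k v a :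
  (forall s k i y, F s -> F (setr s 6 k i y)) -> (k < nvars n)%N ->
  F s -> building s nc P L -> neval s x = k -> reval e s v = a ->
  runs (add_term x v) s 1
    (fun s' => F s' /\ building s' nc P (fun X => L X + a * X k)).
Proof.
move=> Fst lk Fs B xk va; have [[_ nc_s] _ _ _ _] := B.
apply: runs_rset; [exact: nc_s|exact: xk|reflexivity|].
split; first exact: Fst.
have -> : reval e s (RAdd (RGet 6 (nvar 9) x) v) = rmem s 6 nc k + a.
  by rewrite -[in RHS]nc_s -xk -va.
exact: building_term.
Qed.

Lemma runs_end_row (F : store R -> Prop) s nc P L v b :
  (forall s k x y, F s -> F (setn (setr s 8 k 0 x) 9 0 0 y)) ->
  F s -> building s nc P L -> reval e s v = b ->
  runs (end_row v) s (1 + 1)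
    (fun s' => F s' /\ building s' nc.+1 (fun X => P X /\ L X <= b) (fun=> 0)).
Proof.
move=> Fst Fs B vb; have [[_ nc_s] _ _ _ _] := B.
apply: runs_seq (_ : runs _ _ _ (fun t => t = setr s 8 nc 0 b)) _.
  by apply: runs_rset; [exact: nc_s|by []|exact: vb|reflexivity].
move=> _ ->; apply: runs_nset; [by []|by []|reflexivity|].
have -> : neval (setr s 8 nc 0 b) (NAdd (nvar 9) (NConst 1)) = nc.+1.
  exact: etrans (f_equal2 addn nc_s (erefl 1%N)) (addn1 _).
by split; [exact: Fst|exact: building_end].
Qed.

Definition ctx (i : nat) (s : store R) :=
  [/\ env s, layout_upto n s, header_ok s & nmem s 6 0 0 = i].

Definition ctx2 (i j : nat) (s : store R) := ctx i s /\ nmem s 7 0 0 = j.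

Lemma neval_idx_dur i x s k : ctx i s -> neval s x = k ->
  neval s (idx_dur x) = (n + k)%N.
Proof. by move=> [[ns _ _ _ _] _ _ _] xk; exact: (f_equal2 addn ns xk). Qed.

Lemma neval_idx_span i s : ctx i s -> neval s idx_span = (n + n)%N.
Proof. by move=> [[ns _ _ _ _] _ _ _]; exact: (f_equal2 addn ns ns). Qed.

Lemma neval_idx_low i s : ctx i s -> neval s idx_low = (n + n + 1)%N.
Proof. by move=> /neval_idx_span h; exact: (f_equal2 addn h (erefl 1%N)). Qed.

Lemma neval_idx_loc i s x y k l : ctx i s -> (k <= n)%N -> neval s x = k ->
  neval s y = l -> neval s (idx_loc x y) = loc_index n k l.
Proof.
move=> [_ [base _ _] _ _] kn xk yl; apply: (f_equal2 addn _ yl).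
by rewrite -(base k kn) -xk.
Qed.

Lemma runs_span_row i s nc P : (i < n)%N -> ctx i s -> building s nc P (fun=> 0) ->
  runs span_row s (1 + (1 + (1 + (1 + 1)))) (fun s' => ctx i s' /\
    building s' nc.+1 (fun X => P X /\ X i + X (n + i)%N <= X (n + n)%N) (fun=> 0)).
Proof.
move=> lin C B; have n0 : (0 < n)%N by exact: leq_ltn_trans lin.
apply: runs_seq (_ : runs _ _ _ _) _.
  apply: (runs_add_term (F := ctx i) (k := i) (a := 1) _ _ C B _ _) => //.
    by rewrite /nvars; lia.
  by case: C.
clear C B; move=> {}s [C B]; apply: runs_seq (_ : runs _ _ _ _) _.
  apply: (runs_add_term (F := ctx i) (k := n + i) (a := 1) _ _ C B _ _) => //.
    by rewrite /nvars; lia.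
  by apply: (neval_idx_dur C); case: C.
clear C B; move=> {}s [C B]; apply: runs_seq (_ : runs _ _ _ _) _.
  apply: (runs_add_term (F := ctx i) (a := 0 - 1) _ _ C B (neval_idx_span C) _) => //.
  by rewrite /nvars; lia.
clear C B; move=> {}s [C B].
apply: runs_weaken (leqnn _) _; first exact: (runs_end_row (F := ctx i) (b := 0) _ C B _).
move=> s' [C' B']; split=> //; apply: building_ext B' _ => X /=.
by split=> -[? ?]; split=> //; lra.
Qed.

Lemma runs_low_row i s nc P : (i < n)%N -> ctx i s -> building s nc P (fun=> 0) ->
  runs low_row s (1 + (1 + (1 + 1))) (fun s' => ctx i s' /\
    building s' nc.+1 (fun X => P X /\ X (n + n + 1)%N <= X (n + i)%N) (fun=> 0)).
Proof.
move=> lin C B; have n0 : (0 < n)%N by exact: leq_ltn_trans lin.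
apply: runs_seq (_ : runs _ _ _ _) _.
  apply: (runs_add_term (F := ctx i) (a := 1) _ _ C B (neval_idx_low C) _) => //.
  by rewrite /nvars; lia.
clear C B; move=> {}s [C B]; apply: runs_seq (_ : runs _ _ _ _) _.
  apply: (runs_add_term (F := ctx i) (k := n + i) (a := 0 - 1) _ _ C B _ _) => //.
    by rewrite /nvars; lia.
  by apply: (neval_idx_dur C); case: C.
clear C B; move=> {}s [C B].
apply: runs_weaken (leqnn _) _; first exact: (runs_end_row (F := ctx i) (b := 0) _ C B _).
move=> s' [C' B']; split=> //; apply: building_ext B' _ => X /=.
by split=> -[? ?]; split=> //; lra.
Qed.

(** The index function [f] lets one proof serve both the row sums and the column sums of y. *)
Lemma runs_sum_row i s nc P x y (f : nat -> nat) :
  (forall j s, (j < n)%N -> ctx2 i j s -> neval s (idx_loc x y) = f j) ->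
  (forall j, (j < n)%N -> (f j < nvars n)%N) ->
  ctx i s -> building s nc P (fun=> 0) ->
  runs (Seq (for_ 7 (add_term (idx_loc x y) (rconst 1))) (end_row (rconst 1))) s
    (n * (1 + 2) + 2 + (1 + 1)) (fun s' => ctx i s' /\
    building s' nc.+1 (fun X => P X /\ \sum_(j < n) X (f j) <= 1) (fun=> 0)).
Proof.
move=> fE f_lt C B.
apply: runs_seq (_ : runs _ _ _ (fun s' => ctx i s' /\
    building s' nc P (fun X => \sum_(j < n) X (f j)))) _.
  apply: (runs_for (Inv := fun j s' => ctx i s' /\
    building s' nc P (fun X => \sum_(k < j) X (f k)))).
  - by move=> j s' [[[]]].
  - split=> //; case: B => h1 h2 h3 h4 h5; split=> // X.
    by rewrite big_ord0; exact: h4.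
  move=> j s' ljn vj [C' B'].
  apply: runs_weaken (leqnn _) _.
    apply: (runs_add_term (F := ctx2 i j) (a := 1) _ (f_lt j ljn) (conj C' vj) B'
       (fE j s' ljn (conj C' vj)) _) => //.
  move=> t [[Ct vt] Bt]; split=> //; split=> //.
  case: Bt => h1 h2 h3 h4 h5; split=> // X.
  rewrite big_ord_recr /=; have := h4 X; rewrite /= mul1r; exact.
clear C B; move=> {}s [C B].
apply: runs_weaken (leqnn _) _; first exact: (runs_end_row (F := ctx i) (b := 1) _ C B _).
by [].
Qed.

Lemma runs_edge_row i j s nc P : (i < n)%N -> (j < n)%N ->
  ctx2 i j s -> building s nc P (fun=> 0) ->
  runs edge_row s (1 + (1 + (1 + (1 + (1 + 1))))) (fun s' => ctx2 i j s' /\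
    building s' nc.+1 (fun X => P X /\
      (adj i j)%:R * (X i + X (n + i)%N - X j) <=
      del i j / r * (X (loc_index n i j) - 1)) (fun=> 0)).
Proof.
move=> lin ljn C B.
have edgeE t : ctx2 i j t -> reval e t edge_ij = (adj i j)%:R.
  by move=> [[[_ ta _ _ _] _ _ ti] tj]; rewrite -ta -[in RHS]ti -tj.
have redE t : ctx2 i j t -> reval e t reduced_delay_ij = del i j / r.
  by move=> [[[_ _ td _ tr] _ _ ti] tj]; rewrite -td -tr -[in RHS]ti -tj.
apply: runs_seq (_ : runs _ _ _ _) _.
  apply: (runs_add_term (F := ctx2 i j) (k := i) _ _ C B _ (edgeE _ C)) => //.
    by rewrite /nvars; lia.
  by case: C => -[].
clear C B; move=> {}s [C B]; apply: runs_seq (_ : runs _ _ _ _) _.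
  apply: (runs_add_term (F := ctx2 i j) (k := n + i) _ _ C B _ (edgeE _ C)) => //.
    by rewrite /nvars; lia.
  by case: C => C _; apply: (neval_idx_dur C); case: C.
clear C B; move=> {}s [C B]; apply: runs_seq (_ : runs _ _ _ _) _.
  apply: (runs_add_term (F := ctx2 i j) (k := j) (a := 0 - (adj i j)%:R) _ _ C B) => //.
  - by rewrite /nvars; lia.
  - by case: C.
  - by rewrite -(edgeE _ C).
clear C B; move=> {}s [C B]; apply: runs_seq (_ : runs _ _ _ _) _.
  apply: (runs_add_term (F := ctx2 i j) (a := 0 - del i j / r) _
    (loc_index_lt lin ljn) C B) => //.
  - by case: C => C Cj; apply: (neval_idx_loc C); [exact: ltnW|case: C|exact: Cj].
  - by rewrite -(redE _ C).
clear C B; move=> {}s [C B].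
apply: runs_weaken (leqnn _) _.
  apply: (runs_end_row (F := ctx2 i j) (b := 0 - del i j / r) _ C B) => //.
  by rewrite -(redE _ C).
move=> s' [C' B']; split=> //; apply: building_ext B' _ => X /=.
by split=> -[? ?]; split=> //; lra.
Qed.

Lemma runs_delay_row i j s nc P : (i < n)%N ->
  ctx2 i j s -> building s nc P (fun=> 0) ->
  runs delay_row s (1 + (1 + 1)) (fun s' => ctx2 i j s' /\
    building s' nc.+1 (fun X => P X /\ del i j / r <= X (n + n + 1)%N) (fun=> 0)).
Proof.
move=> lin C B.
have redE t : ctx2 i j t -> reval e t reduced_delay_ij = del i j / r.
  by move=> [[[_ _ td _ tr] _ _ ti] tj]; rewrite -td -tr -[in RHS]ti -tj.
apply: runs_seq (_ : runs _ _ _ _) _.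
  have [C1 _] := C.
  apply: (runs_add_term (F := ctx2 i j) (a := 0 - 1) _ _ C B (neval_idx_low C1) _) => //.
  by rewrite /nvars; lia.
clear C B; move=> {}s [C B].
apply: runs_weaken (leqnn _) _.
  apply: (runs_end_row (F := ctx2 i j) (b := 0 - del i j / r) _ C B) => //.
  by rewrite -(redE _ C).
move=> s' [C' B']; split=> //; apply: building_ext B' _ => X /=.
by split=> -[? ?]; split=> //; lra.
Qed.

Definition edge_rows (i m : nat) (X : nat -> R) :=
  forall j, (j < m)%N ->
    (adj i j)%:R * (X i + X (n + i)%N - X j) <=
      del i j / r * (X (loc_index n i j) - 1) /\
    del i j / r <= X (n + n + 1)%N.

Definition task_rows (m : nat) (X : nat -> R) :=
  forall i, (i < m)%N ->
    [/\ X i + X (n + i)%N <= X (n + n)%N, X (n + n + 1)%N <= X (n + i)%N,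
        \sum_(j < n) X (loc_index n i j) <= 1,
        \sum_(j < n) X (loc_index n j i) <= 1 & edge_rows i n X].

Lemma forall_ltnS (Q : nat -> Prop) m :
  (forall i, (i < m.+1)%N -> Q i) <-> (forall i, (i < m)%N -> Q i) /\ Q m.
Proof.
split=> [H|[H Qm] i]; first by split=> [i im|]; apply: H => //; exact: ltnW.
by rewrite ltnS leq_eqVlt => /orP[/eqP ->|/H].
Qed.

Definition rows_time := 
  (n * (1 + (1 + (1 + (1 + 1))) + (1 + (1 + (1 + 1)) + (n * (1 + 2) + 2 + (1 + 1) +
   (n * (1 + 2) + 2 + (1 + 1) +
   (n * (1 + (1 + (1 + (1 + (1 + 1)))) + (1 + (1 + 1)) + 2) + 2)))) + 2) + 2)%N.

(** Row 0 is reserved, and each task adds four rows of its own and two for each ordered pair it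
    starts, hence the row number 1 + i (4 + 2n) before task i. *)
Lemma runs_rows s : env s -> layout_upto n s -> header_ok s ->
  building s 1 (fun=> True) (fun=> 0) ->
  runs program_rows s rows_time (fun s' => ctx (nmem s' 6 0 0) s' /\
    building s' (1 + n * (4 + 2 * n)) (task_rows n) (fun=> 0)).
Proof.
move=> env_s lay_s hd_s B_s.
apply: (runs_for (Inv := fun i s' => ctx (nmem s' 6 0 0) s' /\
    building s' (1 + i * (4 + 2 * n)) (task_rows i) (fun=> 0))).
  - by move=> j s' [[[]]].
  - by split=> //; apply: building_ext B_s _ => X; split.
  clear env_s lay_s hd_s B_s; move=> i {}s lin vi [C B]; rewrite vi in C.
  apply: runs_seq (_ : runs _ _ _ _) _; first exact: runs_span_row lin C B.
  clear vi C B; move=> {}s [C B].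
  apply: runs_seq (_ : runs _ _ _ _) _; first exact: runs_low_row lin C B.
  clear C B; move=> {}s [C B].
  apply: runs_seq (_ : runs _ _ _ _) _.
    apply: (runs_sum_row (f := fun j => loc_index n i j)) C B.
    - move=> j t _ [Ct tj]; apply: (neval_idx_loc Ct); [exact: ltnW|by case: Ct|exact: tj].
    - by move=> j; exact: loc_index_lt.
  clear C B; move=> {}s [C B].
  apply: runs_seq (_ : runs _ _ _ _) _.
    apply: (runs_sum_row (f := fun j => loc_index n j i)) C B.
    - move=> j t ? [Ct tj]; apply: (neval_idx_loc Ct); [exact: ltnW|exact: tj|by case: Ct].
    - by move=> j ?; exact: loc_index_lt.
  clear C B; move=> {}s [C B].
  move: B; set P := (fun X : nat -> R => _) => B.
  apply: runs_weaken (leqnn _) _.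
    apply: (runs_for (Inv := fun j s' => ctx i s' /\
      building s' (1 + i * (4 + 2 * n) + 4 + 2 * j)
        (fun X => P X /\ edge_rows i j X) (fun=> 0))).
    - by move=> j s' [[[]]].
    - split=> //; rewrite muln0 addn0 !addnS addn0; apply: building_ext B _ => X.
      by split=> [|[]] // PX; split.
    clear C B; move=> j {}s ljn vj [C B].
    apply: runs_seq (_ : runs _ _ _ _) _; first exact: runs_edge_row lin ljn (conj C vj) B.
    clear vj C B; move=> {}s [C B].
    apply: runs_weaken (leqnn _) _; first exact: runs_delay_row lin C B.
    clear C B; move=> {}s [[C vj] B]; split=> //; split=> //.
    rewrite mulnS addnCA add2n; apply: building_ext B _ => X.
    by rewrite /edge_rows forall_ltnS; tauto.
  clear C B; move=> {}s [C B]; have vi : nmem s 6 0 0 = i by case: C.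
  split=> //; split; first by case: C.
  have -> : (1 + i.+1 * (4 + 2 * n) = 1 + i * (4 + 2 * n) + 4 + 2 * n)%N.
    by rewrite mulSn; lia.
  apply: building_ext B _ => X; rewrite /task_rows forall_ltnS /P.
  by split=> [[[[[[? ?] ?] ?] ?] ?]|[? [? ? ? ? ?]]] //; do ?split.
Qed.

Lemma runs_header s : env s -> layout_upto n s ->
  (forall i, rmem s 5 i 0 = 0) -> (forall k i, rmem s 6 k i = 0) ->
  runs program_header s (1 + (1 + 1)) (fun s' =>
    [/\ env s', layout_upto n s', header_ok s' & building s' 1 (fun=> True) (fun=> 0)]).
Proof.
move=> env_s lay_s obj0 lin0; have [n_s _ _ E_s _] := env_s.
apply: runs_seq (_ : runs _ _ _ (fun t => t = setr s 5 (n + n) 0 1)) _.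
  by apply: runs_rset; [exact: (f_equal2 addn n_s n_s)|by []|by []|reflexivity].
move=> _ ->; set s1 := setr s 5 _ _ _.
apply: runs_seq (_ : runs _ _ _ (fun t => t = setr s1 8 0 0 E)) _.
  by apply: runs_rset; [by []|by []|exact: E_s|reflexivity].
move=> _ ->; apply: runs_nset; [by []|by []|by []|].
split=> // [i|].
  by rewrite /= /upd /= eqxx andbT; case: eqP => // _; rewrite obj0.
split=> // [||X|X].
- by split=> // i; exact: lin0.
- by move=> k i _; exact: lin0.
- by rewrite /row_value big1// => i _; rewrite [rmem _ _ _ _]lin0 mul0r.
by split=> // _ k; lia.
Qed.

(** * The stored query is the relaxation *)

Definition coeffs (nv : nat) (x : 'cV[R]_nv) (i : nat) : R :=
  if insub i is Some i' then x i' ord0 else 0.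

Lemma coeffs_ord nv (x : 'cV[R]_nv) (i : 'I_nv) : coeffs x i = x i ord0.
Proof. by rewrite /coeffs valK. Qed.

Definition relaxation (X : nat -> R) :=
  [/\ (forall i, (i < nvars n)%N -> 0 <= X i),
      \sum_(j < n) e j (X (n + j)%N) <= E & task_rows n X].

Lemma sum_duration_vars (F : nat -> R) :
  \sum_(i < nvars n) (if (n <= i < n + n)%N then F i else 0) = \sum_(j < n) F (n + j)%N.
Proof.
rewrite /nvars big_split_ord/= big1 ?add0r => [|i _]; last first.
  by case: ifP => //; have := ltn_ord i; lia.
rewrite big_split_ord/= [X in _ + X]big1 ?addr0 => [|i _]; last by case: ifP => //; lia.
by apply: eq_bigr => i _; case: ifP => //; have := ltn_ord i; lia.
Qed.

Lemma query_relaxation s i nc :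
  ctx i s -> building s nc (task_rows n) (fun=> 0) ->
  let P := query n s (nvars n) nc 5 6 7 8 5 in
  [/\ cp_convex P,
      (forall x, cp_feasible e P x <-> relaxation (coeffs x)),
      (forall x, cp_value P x = coeffs x (n + n)%N) &
      (forall k i, cp_wgt P k i != 0 -> (n <= i < n + n)%N)].
Proof.
move=> [_ [_ fct wgt] obj _] [[nc0 _] [z0 E_s] _ _ rowsP] P.
have fct' k : (n <= k)%N -> (k < n + n)%N -> nmem s 5 k 0 = (k - n)%N.
  by move=> nk kn; have := fct (k - n)%N; rewrite subnKC//; apply; lia.
split.
- by move=> k l; rewrite mxE wgt; case: ifP.
- move=> x.
  have row0 : \sum_l (cp_lin P (Ordinal nc0) l * x l ord0 +
      if cp_fct P l is Some j then cp_wgt P (Ordinal nc0) l * e j (x l ord0) else 0)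
      = \sum_(j < n) e j (coeffs x (n + j)%N).
    pose F k := if insub (k - n)%N is Some j then e j (coeffs x k) else 0.
    rewrite (eq_bigr (fun j : 'I_n => F (n + j)%N)); last first.
      by move=> j _; rewrite /F addKn valK.
    rewrite -sum_duration_vars; apply: eq_bigr => l _.
    rewrite !mxE z0 mul0r add0r wgt /= /F.
    (* Outside the durations array 5 may still name a task, but the weight there is 0. *)
    case: ifP => [/andP[nl1 nl2]|_]; last by case: insub => // j; rewrite mul0r.
    rewrite -(fct' l)//.
    by case: insub => // j; rewrite mul1r coeffs_ord.
  have row k (k0 : (0 < k)%N) (kn : (k < nc)%N) :
      \sum_l (cp_lin P (Ordinal kn) l * x l ord0 +
      if cp_fct P l is Some j then cp_wgt P (Ordinal kn) l * e j (x l ord0) else 0)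
      = row_value s k (coeffs x).
    apply: eq_bigr => l _; rewrite !mxE wgt gtn_eqF//= coeffs_ord.
    by case: insub => [j|]; rewrite ?mul0r addr0.
  split=> [[x0 xr]|[x0 xE /rowsP xr]]; split.
  + by move=> l ln; rewrite -[l]/(val (Ordinal ln)) coeffs_ord.
  + by rewrite -row0; apply: le_trans (xr _) _; rewrite mxE E_s.
  + apply/rowsP => k /andP[k0 kn]; rewrite -(row k k0 kn).
    by apply: le_trans (xr _) _; rewrite mxE.
  + by move=> l; rewrite -coeffs_ord x0.
  + move=> [[|k] kn].
      rewrite (_ : Ordinal kn = Ordinal nc0) ?row0 ?mxE ?E_s//; exact: val_inj.
    by rewrite row// mxE; exact: xr.
- move=> x; have n2 : (n + n < nvars n)%N by rewrite /nvars; lia.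
  rewrite -[(n + n)%N]/(val (Ordinal n2)) coeffs_ord /cp_value.
  rewrite (bigD1 (Ordinal n2))//= mxE obj eqxx mul1r big1 ?addr0// => l.
  by rewrite -val_eqE mxE obj /= => /negPf ->; rewrite mul0r.
by move=> k l; rewrite mxE wgt; case: ifP => [/andP[]//|]; rewrite eqxx.
Qed.

Lemma runs_solve s nv nc x1 x2 Q :
  neval s x1 = nv -> neval s x2 = nc ->
  Q (put_col s 9 (slv (query n s nv nc 5 6 7 8 5))) ->
  runs (Solve x1 x2 5 6 7 8 5 9) s (nv.+1 * nc.+1) Q.
Proof.
move=> <- <- q; eexists _, _; split; [exact: ExSolve|exact: leqnn|exact: q].
Qed.

(** * Rounding and merging in the store *)

Definition rctx (X : nat -> R) (s : store R) :=
  [/\ env s, (forall i, (i <= n)%N -> nmem s 4 i 0 = (n + n + 2 + i * n)%N) &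
      (forall i, (i < nvars n)%N -> rmem s 9 i 0 = X i)].

Definition rounded (X : nat -> R) (m : nat) (s : store R) :=
  forall j, (j < m)%N -> rmem s 3 j 0 = 2 * (r + 1) / 3 * X j /\ rmem s 4 j 0 = X (n + j)%N.

Lemma runs_round X s : rctx X s ->
  runs round_solution s (n * (1 + (1 + 1) + 2) + 2) (fun s' =>
    [/\ rctx X s', rounded X n s' & forall j, (j < n)%N -> nmem s' 3 j 0 = j]).
Proof.
move=> C.
apply: (runs_for (Inv := fun m s' => [/\ rctx X s', rounded X m s' &
  forall j, (j < m)%N -> nmem s' 3 j 0 = j])) => //.
  by move=> i t [[[]]].
move=> i {C}s lin vi [C Rd pr]; have [[n_s _ _ _ r_s] base xs] := C.
apply: runs_seq (_ : runs _ _ _ (fun t => t = setr s 3 i 0 (2 * (r + 1) / 3 * X i))) _.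
  apply: runs_rset; [exact: vi|by []| |reflexivity].
  by rewrite -r_s -xs ?(ltn_addr _ lin)// -[in RHS]vi.
move=> _ ->; set s1 := setr s _ _ _ _.
apply: runs_seq (_ : runs _ _ _ (fun t => t = setr s1 4 i 0 (X (n + i)%N))) _.
  apply: runs_rset; [exact: vi|by []| |reflexivity].
  by rewrite -xs -?[in RHS]n_s -?[in RHS]vi//; rewrite /nvars; lia.
move=> _ ->; apply: runs_nset; [exact: vi|by []|exact: vi|].
split=> //; split=> // j; rewrite ltnS leq_eqVlt => /orP[/eqP ->|ji].
- by split; exact: upd_same.
- by rewrite /= /upd /= !(ltn_eqF ji)/=; exact: Rd.
- exact: upd_same.
- by rewrite /= /upd /= (ltn_eqF ji)/=; exact: pr.
Qed.

Definition local_edge (X : nat -> R) (i j : nat) : bool :=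
  (0 < adj i j)%N && ~~ (X (loc_index n i j) + X (loc_index n i j) <= 1).

(** The soundness half of merging: tasks share a label only if [C] relates them. Labels stay below
    n, so they denote processors once n <= m. *)
Definition labelled (C : nat -> nat -> Prop) (s : store R) :=
  (forall k, (k < n)%N -> (nmem s 3 k 0 < n)%N) /\
  (forall k l, (k < n)%N -> (l < n)%N -> nmem s 3 k 0 = nmem s 3 l 0 -> C k l).

Definition mctx (X : nat -> R) (s : store R) := rctx X s /\ rounded X n s.

Lemma runs_relabel X s i j a b :
  mctx X s -> nmem s 6 0 0 = i -> nmem s 7 0 0 = j ->
  nmem s 10 0 0 = a -> nmem s 11 0 0 = b ->
  runs relabel s (n * (1.+1 + 2) + 2) (fun s' =>
    [/\ mctx X s', nmem s' 6 0 0 = i, nmem s' 7 0 0 = j &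
        forall k, (k < n)%N ->
          nmem s' 3 k 0 = if nmem s 3 k 0 == b then a else nmem s 3 k 0]).
Proof.
move=> C vi vj va vb; pose p k := nmem s 3 k 0.
apply: runs_weaken (leqnn _) _.
  apply: (runs_for (Inv := fun m t => [/\ mctx X t, nmem t 6 0 0 = i, nmem t 7 0 0 = j,
      nmem t 10 0 0 = a /\ nmem t 11 0 0 = b &
      forall k, (k < n)%N ->
        nmem t 3 k 0 = if (k < m)%N && (p k == b) then a else p k])).
  - by move=> m t [[[[]]]].
  - by split.
  move=> k t kn vk [Ct ti tj [ta tb] pt].
  have eqE : beval e t (BAnd (BNLe (NGet 3 task_k (NConst 0)) (nvar 11))
              (BNLe (nvar 11) (NGet 3 task_k (NConst 0)))) = (p k == b).
    rewrite /= vk tb pt// ltnn /=; lia.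
  apply: runs_if; rewrite eqE => pkb.
    apply: runs_nset; [exact: vk|by []|exact: ta|].
    split=> //; split=> // l ln.
    rewrite /= /upd /= andbT ltnS [(l <= k)%N]leq_eqVlt.
    by case: eqP => [->|_]/=; [rewrite pkb|rewrite pt].
  apply: runs_skip; split=> //; split=> // l ln.
  rewrite [LHS]pt// ltnS [(l <= k)%N]leq_eqVlt.
  by have [->|_] := eqVneq l k; rewrite ?(negPf pkb) ?andbF.
by move=> t [Ct ti tj _ pt]; split=> // k kn; rewrite pt// kn.
Qed.

(** Relabelling acts on labels, so equal labels stay equal and one pass over the pairs suffices. It
    only unites the classes of i and j for a local edge, which an equivalence [C] containing the
    local edges already relates. *)
Lemma runs_merge X s (C : nat -> nat -> Prop) : (forall k, C k k) ->
  (forall k l, (k < n)%N -> (l < n)%N -> C k l -> C l k) ->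
  (forall k l m, (k < n)%N -> (l < n)%N -> (m < n)%N -> C k l -> C l m -> C k m) ->
  (forall k l, (k < n)%N -> (l < n)%N -> local_edge X k l -> C k l) ->
  mctx X s -> (forall j, (j < n)%N -> nmem s 3 j 0 = j) ->
  runs merge_chains s
    (n * (n * ((1 + (1 + (n * (1.+1 + 2) + 2))).+1 + 2) + 2 + 2) + 2) (fun s' =>
    [/\ rounded X n s', labelled C s' &
        forall k l, (k < n)%N -> (l < n)%N -> local_edge X k l ->
          nmem s' 3 k 0 = nmem s' 3 l 0]).
Proof.
move=> Crefl Csym Ctrans Cloc Cs ps.
pose merged i (t : store R) := forall k l, (k < i)%N -> (l < n)%N -> local_edge X k l ->
  nmem t 3 k 0 = nmem t 3 l 0.
apply: runs_weaken (leqnn _) _.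
  apply: (runs_for (Inv := fun i t => [/\ mctx X t, labelled C t & merged i t])).
  - by move=> m t [[[[]]]].
  - split=> //; split=> [k kn|k l kn ln]; first by rewrite [nmem _ _ _ _]ps.
    by rewrite [LHS]ps// [X in _ = X]ps// => ->.
  move=> i {Cs ps}s lin vi [Cs ps ms].
  apply: runs_weaken (leqnn _) _.
    apply: (runs_for (Inv := fun j t => [/\ mctx X t, nmem t 6 0 0 = i, labelled C t,
        merged i t & forall l, (l < j)%N -> local_edge X i l -> nmem t 3 i 0 = nmem t 3 l 0])).
    - by move=> m t [[[[]]]].
    - by split.
    move=> j {Cs ps ms vi}s ljn vj [Cs vi ps ms mi].
    have locE : beval e s is_local = local_edge X i j.
      have [[[n_s a_s _ _ _] base xs] _] := Cs.
      rewrite /local_edge /= vi vj a_s base ?(ltnW lin)// -[(_ + _ + _)%N]/(loc_index n i j).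
      by rewrite xs// loc_index_lt.
    apply: runs_if; rewrite locE => lij; last first.
      eexists _, _; split; [exact: ExSkip|by []|].
      split=> //; split=> // l; rewrite ltnS leq_eqVlt => /orP[/eqP -> lij'|lj].
        by rewrite lij' in lij.
      exact: mi.
    apply: runs_seq (_ : runs _ _ _ (fun t => t = setn s 10 0 0 (nmem s 3 i 0))) _.
      by apply: runs_nset; [by []|by []| |reflexivity]; rewrite -[in RHS]vi.
    move=> _ ->; set s1 := setn s _ _ _ _.
    apply: runs_seq (_ : runs _ _ _ (fun t => t = setn s1 11 0 0 (nmem s 3 j 0))) _.
      by apply: runs_nset; [by []|by []| |reflexivity]; rewrite -[in RHS]vj.
    move=> _ ->; set s2 := setn s1 _ _ _ _.
    apply: runs_weaken (leqnn _) _.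
      exact: (@runs_relabel X s2 i j (nmem s 3 i 0) (nmem s 3 j 0) Cs vi vj).
    move=> t [Ct ti tj pt]; split=> //; have [plt pC] := ps.
    have {}pt k : (k < n)%N -> nmem t 3 k 0 =
        if nmem s 3 k 0 == nmem s 3 j 0 then nmem s 3 i 0 else nmem s 3 k 0.
      exact: pt.
    split=> //.
    - split=> [k kn|k l kn ln].
        by rewrite [nmem _ _ _ _]pt//; case: ifP => _; exact: plt.
      rewrite [LHS]pt// [X in _ = X]pt//.
      have Cij := Cloc _ _ lin ljn lij.
      case: eqP => [kj|_]; case: eqP => [lj|_] h.
      + by apply: pC; rewrite ?kj ?lj.
      + have Ckj := pC _ _ kn ljn kj; have Cil := pC _ _ lin ln h.
        apply: (Ctrans _ i) => //; apply: (Ctrans _ j) => //; exact: Csym.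
      + have Clj := pC _ _ ln ljn lj; have Cki := pC _ _ kn lin h.
        apply: (Ctrans _ i) => //; apply: (Ctrans _ j) => //; exact: Csym.
      + exact: pC.
    - move=> k l ki ln kl; have kn := ltn_trans ki lin.
      by rewrite [LHS]pt// [RHS]pt// (ms k l ki ln kl).
    move=> l; rewrite ltnS leq_eqVlt => /orP[/eqP -> _|lj il].
      by rewrite [LHS]pt// [RHS]pt// eqxx; case: ifP.
    have ln := ltn_trans lj ljn.
    by rewrite [LHS]pt// [RHS]pt// (mi l lj il).
  move=> t [Ct ti pt mt it]; split=> //; split=> // k l.
  by rewrite ltnS leq_eqVlt => /orP[/eqP -> ln|ki ln]; [exact: it|exact: mt].
by move=> t [[Ct Rt] pt mt]; split.
Qed.

End Build.

(** * Linear chains *)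

Section Chains.
Variables (T : finType) (e : rel T).

Definition chained : rel T := [rel x y | connect e x y || connect e y x].

Hypothesis e_inj : forall x y z, e x z -> e y z -> x = y.
Hypothesis e_fun : forall x y z, e x y -> e x z -> y = z.

(** In a deterministic graph, one of two paths from x is a prefix of the other. *)
Lemma connect_fun (f : rel T) : (forall x y z, f x y -> f x z -> y = z) ->
  forall x y z, connect f x y -> connect f x z -> connect f y z || connect f z y.
Proof.
move=> f_fun x y z /connectP[p]; elim: p x => [|a p IH] x /=.
  by move=> _ -> ->.
move=> /andP[xa ap] yE /connectP[[|b q] /=].
  move=> _ ->; apply/orP; right; apply: connect_trans (connect1 xa) _.
  by apply/connectP; exists p.
move=> /andP[xb bq] zE; apply: (IH a ap yE).
by rewrite (f_fun _ _ _ xa xb); apply/connectP; exists q.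
Qed.

Lemma chained_sym x y : chained x y = chained y x.
Proof. by rewrite /chained /= orbC. Qed.

(** Two paths leaving y are comparable by [e_fun]; two paths entering y are comparable by [e_inj],
    applied to the reversed relation. *)
Lemma chained_trans x y z : chained x y -> chained y z -> chained x z.
Proof.
move=> /orP[xy|yx] /orP[yz|zy]; rewrite /chained /=.
- by rewrite (connect_trans xy yz).
- have e'_fun a b c : e b a -> e c a -> b = c by exact: e_inj.
  have rev a b : connect [rel a b | e b a] a b = connect e b a := connect_rev e a b.
  by have := @connect_fun [rel a b | e b a] e'_fun y x z; rewrite !rev orbC; exact.
- exact: connect_fun yx yz.
- by rewrite (connect_trans zy yx) orbT.
Qed.

End Chains.

(** Two distinct terms above 1/2 would already exceed 1. Doubling avoids the fraction, as in the
    test of the program. *)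
Lemma sum_le1_uniq (R : realDomainType) (I : finType) (F : I -> R) i j :
  (forall k, 0 <= F k) -> \sum_k F k <= 1 -> 1 < F i + F i -> 1 < F j + F j -> i = j.
Proof.
move=> F0 S1 Fi Fj; apply/eqP/negP => /negP ij.
rewrite (bigD1 i)//= (bigD1 j)/= 1?eq_sym// in S1.
have : 0 <= \sum_(k | (k != i) && (k != j)) F k by exact: sumr_ge0.
by move=> h; lra.
Qed.

Lemma sum_bool_le1 (R : realDomainType) (I : finType) (b : pred I) :
  (forall i j, b i -> b j -> i = j) -> \sum_i (b i)%:R <= 1 :> R.
Proof.
move=> bu; case: (pickP b) => [i bi|b0].
  rewrite (bigD1 i)//= bi big1 ?addr0// => j ji.
  by case bj: (b j) => //; rewrite (bu i j bi bj) eqxx in ji.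
by rewrite big1// => i _; rewrite b0.
Qed.

(** * The relaxation *)

Section Relaxation.
Variables (R : realType) (n m : nat) (I : instance R n m) (r : R).
Hypotheses (valid_I : valid_instance I) (r1 : 1 <= r).

Local Notation adj := (nmem (input I r) 2).
Local Notation del := (rmem (input I r) 0).
Local Notation relaxed := (relaxation (n := n) (energy I) adj del (budget I) r).

Lemma adjE (i j : 'I_n) : adj i j = prec I i j.
Proof. by rewrite /= !valK. Qed.

Lemma delE (i j : 'I_n) : del i j = if prec I i j then delay I i j else 0.
Proof. by rewrite /= !valK. Qed.

Lemma del_ge0 (i j : 'I_n) : 0 <= del i j.
Proof. by rewrite delE; case: ifP => // ij; have [_ + _ _] := valid_I; exact. Qed.

(** * From a relaxed solution to a schedule *)

Section Rounding.
Variable X : nat -> R.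
Hypothesis relX : relaxed X.

Let X_ge0 i : (i < nvars n)%N -> 0 <= X i.
Proof. by case: relX => + _ _; exact. Qed.

Lemma relaxed_dur_ge0 (i : 'I_n) : 0 <= X (n + i)%N.
Proof. by apply: X_ge0; rewrite /nvars; have := ltn_ord i; lia. Qed.

Lemma relaxed_start_ge0 (i : 'I_n) : 0 <= X i.
Proof. by apply: X_ge0; rewrite /nvars; have := ltn_ord i; lia. Qed.

Lemma relaxed_loc_ge0 (i j : 'I_n) : 0 <= X (loc_index n i j).
Proof. exact/X_ge0/loc_index_lt. Qed.

Lemma local_edge_fun (i j k : 'I_n) : local_edge n adj X i j -> local_edge n adj X i k -> j = k.
Proof.
have [_ _ /(_ i (ltn_ord i))[_ _ S1 _ _]] := relX.
rewrite /local_edge -!ltNge => /andP[_ ij] /andP[_ ik].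
exact: (@sum_le1_uniq _ _ (fun j : 'I_n => X (loc_index n i j)) j k (relaxed_loc_ge0 i)).
Qed.

Lemma local_edge_inj (i j k : 'I_n) : local_edge n adj X i k -> local_edge n adj X j k -> i = j.
Proof.
have [_ _ /(_ k (ltn_ord k))[_ _ _ S1 _]] := relX.
rewrite /local_edge -!ltNge => /andP[_ ij] /andP[_ ik].
exact: (@sum_le1_uniq _ _ (fun j : 'I_n => X (loc_index n j k)) i j
  (fun j => relaxed_loc_ge0 j k)).
Qed.

Local Notation lambda := (2 * (r + 1) / 3).

Lemma relaxed_edge (i j : 'I_n) : prec I i j ->
  lambda * X i + X (n + i)%N <= lambda * X j /\
  (~~ local_edge n adj X i j -> lambda * X i + X (n + i)%N + delay I i j <= lambda * X j).
Proof.
move=> ij; have [_ _ /(_ i (ltn_ord i))[_ low S1 _ /(_ j (ltn_ord j))[]]] := relX.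
have r_ge1 := r1; have r0 : 0 < r by lra.
rewrite adjE delE ij mul1r; set q := delay I i j / r => edge qlow.
have qr : delay I i j = q * r by rewrite /q divfK ?gt_eqF.
have q0 : 0 <= q.
  by have := del_ge0 i j; rewrite delE ij => d0; rewrite divr_ge0// ltW.
have y0 := relaxed_loc_ge0 i j.
have y1 : X (loc_index n i j) <= 1.
  apply: le_trans S1; rewrite (bigD1 j)//= lerDl.
  by apply: sumr_ge0 => k _; exact: relaxed_loc_ge0.
have d0 := relaxed_dur_ge0 i.
have qd : q <= X (n + i)%N by exact: le_trans qlow low.
have lam0 : 0 <= lambda by lra.
split.
  have qy : 0 <= q * (1 - X (loc_index n i j)) by rewrite mulr_ge0 ?subr_ge0.
  have step : X i + X (n + i)%N <= X j by lra.
  (* The gap is dilated but the duration is not, so the precedence follows from lambda >= 1. *)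
  have lam1 : 0 <= (lambda - 1) * X (n + i)%N by apply: mulr_ge0 => //; lra.
  by have := ler_wpM2l lam0 step; lra.
rewrite /local_edge adjE ij /= negbK => y2.
have qy : 0 <= q * (1 / 2 - X (loc_index n i j)) by apply: mulr_ge0 => //; lra.
have step : X i + X (n + i)%N + q / 2 <= X j by lra.
have := ler_wpM2l lam0 step; rewrite qr.
(* This is the slack of the dilated constraint. *)
have : 0 <= (2 * r - 1) / 3 * (X (n + i)%N - q) by apply: mulr_ge0; lra.
by lra.
Qed.

Local Notation local_rel := [rel i j : 'I_n | local_edge n adj X i j].

(** The intervals along a path of local edges follow one another, which is what lets a whole chain
    share a processor. *)
Lemma connect_local (i j : 'I_n) : connect local_rel i j ->
  i = j \/ lambda * X i + X (n + i)%N <= lambda * X j.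
Proof.
move=> /connectP[p]; elim: p i => [|a p IH] i /=; first by left.
move=> /andP[ia ap] jE; right.
have {}ia : local_edge n adj X i a := ia.
have pia : prec I i a by move: ia; rewrite /local_edge adjE lt0b => /andP[].
have [h _] := relaxed_edge pia.
have [<-//|h2] := IH a ap jE.
have := relaxed_dur_ge0 a; lra.
Qed.

(** The two processor hypotheses play opposite roles: keeping a local edge on one processor exempts
    it from its delay, while sharing a processor only within a chain rules out overlaps. *)
Lemma rounding_feasible (S : schedule R n m) :
  (forall j, start S j = lambda * X j) -> (forall j, dur S j = X (n + j)%N) ->
  (forall i j : 'I_n, local_edge n adj X i j -> proc S i = proc S j) ->
  (forall i j, proc S i = proc S j -> chained local_rel i j) ->
  feasible I S /\ makespan S <= lambda * X (n + n)%N.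
Proof.
move=> St Sd Sloc Scmp; have r_ge1 := r1; have [_ XE Xrow] := relX.
split; last first.
  apply: bigmax_le => [|j _].
    by apply: mulr_ge0; [lra|apply: X_ge0; rewrite /nvars; lia].
  rewrite St Sd; have [h _ _ _ _] := Xrow j (ltn_ord j).
  have := relaxed_dur_ge0 j; have lam0 : 0 <= lambda by lra.
  have := ler_wpM2l lam0 h; nra.
split.
- move=> j; rewrite St Sd; split; last exact: relaxed_dur_ge0.
  by apply: mulr_ge0; [lra|exact: relaxed_start_ge0].
- move=> i j ij; rewrite !St !Sd; have [h1 h2] := relaxed_edge ij.
  by split=> // /eqP pij; apply: h2; apply/negP => /Sloc.
- move=> i j /eqP ij /Scmp /orP[] /connect_local; rewrite !St !Sd.
    by case=> // ?; left.
  by case=> [/esym//|?]; right.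
- by rewrite (eq_bigr _ (fun j _ => congr1 (energy I j) (Sd j))).
Qed.

(** With one processor per task, [X] itself is a schedule, undilated; this makes the relaxation
    exact in the case without delays. *)
Lemma relaxed_no_delay : (n <= m)%N -> (forall i j, prec I i j -> delay I i j = 0) ->
  exists S : schedule R n m,
  [/\ feasible I S, delays_bounded I r S & makespan S <= X (n + n)%N].
Proof.
move=> le_nm nodelay; have r_ge1 := r1; have [_ XE Xrow] := relX.
exists (Schedule (fun j : 'I_n => X j) (fun j : 'I_n => X (n + j)%N) (widen_ord le_nm)).
split; last first.
- apply: bigmax_le => [|j _]; first by apply: X_ge0; rewrite /nvars; lia.
  by have [] := Xrow j (ltn_ord j).
- move=> i j k ij /=; rewrite nodelay//; apply: mulr_ge0; first by lra.
  exact: relaxed_dur_ge0.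
split=> //=.
- by move=> j; split; [exact: relaxed_start_ge0|exact: relaxed_dur_ge0].
- move=> i j ij; have [_ _ _ _ /(_ j (ltn_ord j))[+ _]] := Xrow i (ltn_ord i).
  rewrite adjE delE ij nodelay// mul0r mul0r mul1r => h.
  by rewrite addr0; split=> [|_]; lra.
- by move=> i j /eqP ij /(congr1 val)/= /val_inj.
Qed.

End Rounding.

(** * From a schedule to a relaxed solution *)

Section LowerBound.
Variable S : schedule R n m.
Hypotheses (feas_S : feasible I S) (bnd_S : delays_bounded I r S).

Definition delay_avoided (i j : 'I_n) : bool :=
  prec I i j && (start S j < start S i + dur S i + delay I i j / r).

(** On distinct processors the full delay is respected, and it is at least the shrunk one because r
    >= 1. *)
Lemma delay_avoided_proc i j : delay_avoided i j -> proc S i = proc S j.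
Proof.
move=> /andP[ij lt]; apply/eqP/negP => /negP pij.
have [_ /(_ i j ij)[_ /(_ pij) sep] _ _] := feas_S.
have r_ge1 := r1; have r0 : 0 < r by lra.
have c0 : 0 <= delay I i j by have [_ + _ _] := valid_I; exact.
have : delay I i j / r <= delay I i j by rewrite ler_pdivrMr// ler_peMr.
lra.
Qed.

Lemma reduced_delay_le_dur (i j k : 'I_n) : prec I i j -> delay I i j / r <= dur S k.
Proof. by move=> ij; rewrite ler_pdivrMr ?(lt_le_trans ltr01 r1)// mulrC; exact: bnd_S. Qed.

Lemma delay_avoided_fun i j k : delay_avoided i j -> delay_avoided i k -> j = k.
Proof.
move=> aij aik; apply/eqP/negP => /negP jk.
have pjk : proc S j = proc S k by rewrite -!(delay_avoided_proc (i := i)).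
have [_ prc dis _] := feas_S; move: aij aik => /andP[ij ltj] /andP[ik ltk].
have [tj _] := prc i j ij; have [tk _] := prc i k ik.
have := reduced_delay_le_dur k ij; have := reduced_delay_le_dur j ik.
by have [] := dis j k jk pjk; lra.
Qed.

Lemma delay_avoided_inj i j k : delay_avoided i k -> delay_avoided j k -> i = j.
Proof.
move=> aik ajk; apply/eqP/negP => /negP ij.
have pij : proc S i = proc S j by rewrite !(delay_avoided_proc (j := k)).
have [_ prc dis _] := feas_S; move: aik ajk => /andP[ik lti] /andP[jk ltj].
have [ti _] := prc i k ik; have [tj _] := prc j k jk.
have := reduced_delay_le_dur j ik; have := reduced_delay_le_dur i jk.
by have [] := dis i j ij pij; lra.
Qed.

(** The least nonnegative value that the delay rows allow; without edges it is 0, still a lower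
    bound on the durations. *)
Definition low_bound : R := \big[Num.max/0]_(p : 'I_n * 'I_n) (del p.1 p.2 / r).

Definition lift_ord (f : 'I_n -> R) (i : nat) : R := if insub i is Some i' then f i' else 0.

(** The value 0 beyond [nvars n] makes this function equal to [coeffs] of the column vector built
    from it. *)
Definition relaxed_solution (i : nat) : R :=
  if (i < n)%N then lift_ord (start S) i
  else if (i < n + n)%N then lift_ord (dur S) (i - n)
  else if i == (n + n)%N then makespan S
  else if i == (n + n + 1)%N then low_bound
  else let p := (i - (n + n + 2))%N in
    if (insub (p %/ n)%N, insub (p %% n)%N) is (Some i', Some j')
    then (delay_avoided i' j')%:R else 0.

Lemma relaxed_solution_start (i : 'I_n) : relaxed_solution i = start S i.
Proof. by rewrite /relaxed_solution ltn_ord /lift_ord valK. Qed.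

Lemma relaxed_solution_dur (i : 'I_n) : relaxed_solution (n + i)%N = dur S i.
Proof.
by rewrite /relaxed_solution ltn_add2l ltn_ord addKn /lift_ord valK; case: ifP => //; lia.
Qed.

Lemma relaxed_solution_span : relaxed_solution (n + n)%N = makespan S.
Proof. by rewrite /relaxed_solution ltnn eqxx; case: ifP => //; lia. Qed.

Lemma relaxed_solution_low : relaxed_solution (n + n + 1)%N = low_bound.
Proof. by rewrite /relaxed_solution eqxx; do 3 (case: ifP; first lia). Qed.

Lemma relaxed_solution_loc (i j : 'I_n) :
  relaxed_solution (loc_index n i j) = (delay_avoided i j)%:R.
Proof.
rewrite /relaxed_solution /loc_index.
have n0 : (0 < n)%N by exact: leq_ltn_trans (ltn_ord i).
have -> : (n + n + 2 + i * n + j - (n + n + 2) = i * n + j)%N by lia.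
rewrite divnMDl// divn_small// addn0 modnMDl modn_small// !valK.
by do 4 (case: ifP; first lia).
Qed.

Lemma relaxed_solution_out i : (nvars n <= i)%N -> relaxed_solution i = 0.
Proof.
rewrite /nvars => ni; rewrite /relaxed_solution.
do 4 (case: ifP => [|_]; first lia).
case: insubP => // i' lti _; have n0 : (0 < n)%N by case: (n) lti.
by move: lti; rewrite ltn_divLR//; lia.
Qed.

Lemma relaxed_solution_ge0 i : 0 <= relaxed_solution i.
Proof.
have [pos _ _ _] := feas_S.
rewrite /relaxed_solution /lift_ord.
case: ifP => _; first by case: insub => // j; have [] := pos j.
case: ifP => _; first by case: insub => // j; have [] := pos j.
case: ifP => _; first exact: bigmax_ge_id.
case: ifP => _; first exact: bigmax_ge_id.
by case: insub => // k; case: insub => // l; rewrite ler0n.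
Qed.

Lemma relaxed_solution_relaxed : relaxed relaxed_solution.
Proof.
have [pos prc _ en] := feas_S.
split=> [i _||k kn].
- exact: relaxed_solution_ge0.
- by rewrite (eq_bigr _ (fun j _ => congr1 (energy I j) (relaxed_solution_dur j))).
pose i := Ordinal kn; rewrite -[k]/(val i).
have r_ge1 := r1; have r0 : 0 < r by lra.
split.
- rewrite relaxed_solution_start relaxed_solution_dur relaxed_solution_span.
  exact: (le_bigmax _ (fun j => start S j + dur S j)).
- rewrite relaxed_solution_dur relaxed_solution_low.
  apply: bigmax_le => [|[j l] _]; first by have [] := pos i.
  rewrite -[leLHS]/(del j l / r).
  rewrite delE; case: ifP => jl; first exact: reduced_delay_le_dur.
  by rewrite mul0r; have [] := pos i.
- rewrite (eq_bigr _ (fun j _ => relaxed_solution_loc i j)).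
  by apply: sum_bool_le1; exact: delay_avoided_fun.
- rewrite (eq_bigr _ (fun j _ => relaxed_solution_loc j i)).
  by apply: sum_bool_le1 => j l; exact: delay_avoided_inj.
move=> l ln; pose j := Ordinal ln; rewrite -[l]/(val j).
split; last first.
  rewrite relaxed_solution_low.
  exact: (le_bigmax _ (fun p : 'I_n * 'I_n => del p.1 p.2 / r) (i, j)).
rewrite relaxed_solution_loc !relaxed_solution_start relaxed_solution_dur adjE delE.
rewrite /delay_avoided; case ij: (prec I i j) => /=; last by rewrite !mul0r.
have [h _] := prc i j ij.
(* If the shrunk delay is avoided then y = 1 and only the precedence remains; otherwise y = 0 and
   the row is the negated test. *)
by case: ltP => h2 /=; lra.
Qed.

End LowerBound.

(* Without delays the relaxation is the scheduling problem itself, whose optimum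
   is attained by hypothesis; a positive delay bounds all durations away from 0. *)
Lemma relaxation_optimum (P : cprog R n) mu :
  cp_nv P = nvars n -> cp_convex P ->
  (forall x, cp_feasible (energy I) P x <-> relaxed (coeffs x)) ->
  (forall x, cp_value P x = coeffs x (n + n)%N) ->
  (forall k i, cp_wgt P k i != 0 -> (n <= i < n + n)%N) ->
  (n <= m)%N -> min_makespan I r mu ->
  (exists x, cp_optimal (energy I) P x) /\
  exists x, cp_feasible (energy I) P x /\ cp_value P x = mu.
Proof.
move=> nvE Pcvx feasE valE wgtE le_nm [[S0 [fS bS mS]] minS].
pose x0 : 'cV[R]_(cp_nv P) := \col_i relaxed_solution S0 i.
have x0E : coeffs x0 = relaxed_solution S0.
  apply/funext => i; rewrite /coeffs; case: insubP => [j _ <-|]; first by rewrite mxE.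
  by rewrite -leqNgt nvE => /relaxed_solution_out ->.
have fx0 : cp_feasible (energy I) P x0.
  by apply/feasE; rewrite x0E; exact: relaxed_solution_relaxed.
have vx0 : cp_value P x0 = mu by rewrite valE x0E relaxed_solution_span.
split; last by exists x0.
have [[[i j] /= /andP[ij c0]]|nodelay] := pselect (exists p : 'I_n * 'I_n,
    prec I p.1 p.2 && (delay I p.1 p.2 != 0)); last first.
  exists x0; split=> // y /feasE fy; rewrite vx0 valE.
  have [|S [fS' bS' mS']] := relaxed_no_delay fy le_nm.
    move=> i j ij; apply/eqP/negP => /negP c0; apply: nodelay.
    by exists (i, j); rewrite /= ij.
  exact: le_trans (minS S fS' bS') mS'.
have r_ge1 := r1; have r0 : 0 < r by lra.
have cpos : 0 < delay I i j by rewrite lt_def c0; have [_ + _ _] := valid_I; exact.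
have n0 : (0 < n)%N by exact: leq_ltn_trans (ltn_ord i).
(* Below value mu, start times, durations and span are at most mu, and so is the low variable, being
   at most the duration of task 0, which exists since there is an edge. Each y is at most 1 by its
   row sum. *)
apply: (@cp_optimal_exists _ _ _ _ (delay I i j / r) (Num.max 1 mu) x0) => //.
- by have [_ _ + _] := valid_I.
- by rewrite divr_gt0.
move=> x /feasE[xpos _ xrow]; rewrite vx0 valE => xmu.
have low : delay I i j / r <= coeffs x (n + n + 1)%N.
  have [_ _ _ _ /(_ j (ltn_ord j))[_]] := xrow i (ltn_ord i).
  by rewrite delE ij.
split; last first.
  move=> k l _ /wgtE /andP[l1 l2]; rewrite -coeffs_ord; apply: le_trans low _.
  have ln : (l - n < n)%N by lia.
  by have [_ + _ _ _] := xrow _ ln; rewrite subnKC.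
move=> l; have lN : (l < nvars n)%N by rewrite -nvE.
rewrite -coeffs_ord le_max.
have task k : (k < n)%N -> coeffs x k <= mu /\ coeffs x (n + k)%N <= mu.
  move=> kn; have [h _ _ _ _] := xrow k kn.
  have : 0 <= coeffs x k by apply: xpos; rewrite /nvars; lia.
  have : 0 <= coeffs x (n + k)%N by apply: xpos; rewrite /nvars; lia.
  by split; lra.
have [ln|nl] := ltnP l n; first by have [-> _] := task l ln; rewrite orbT.
have [l2|nl2] := ltnP l (n + n).
  have ln : (l - n < n)%N by lia.
  by have [_] := task _ ln; rewrite subnKC// => ->; rewrite orbT.
have [->|l3] := eqVneq (l : nat) (n + n)%N; first by rewrite xmu orbT.
have [->|l4] := eqVneq (l : nat) (n + n + 1)%N.
  have [_ h _ _ _] := xrow 0%N n0; have [_ h2] := task 0%N n0.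
  by rewrite (le_trans h h2) orbT.
pose p := (l - (n + n + 2))%N; have pn : (p < n * n)%N by rewrite /nvars in lN; lia.
have dn : (p %/ n < n)%N by rewrite ltn_divLR.
have mn : (p %% n < n)%N by rewrite ltn_mod.
have -> : (l : nat) = loc_index n (Ordinal dn) (Ordinal mn).
  by rewrite /loc_index /= -addnA -divn_eq /p; lia.
have [_ _ S1 _ _] := xrow _ dn.
apply/orP; left; apply: le_trans S1; rewrite (bigD1 (Ordinal mn))//= lerDl.
apply: sumr_ge0 => k _; apply: xpos; exact: loc_index_lt.
Qed.

End Relaxation.

(** * Running time and conclusion *)

Definition scheduler_time (n : nat) : nat :=
  1 + (n * (1 + (1 + 1) + 2) + 2) + (1 + (1 + 1) + (rows_time n +
  ((nvars n).+1 * (1 + n * (4 + 2 * n)).+1 + (n * (1 + (1 + 1) + 2) + 2 +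
  (n * (n * ((1 + (1 + (n * (1.+1 + 2) + 2))).+1 + 2) + 2 + 2) + 2))))).

(** The quartic term comes from the solver call, with about n^2 variables and 2 n^2 rows; merging is
    cubic. *)
Lemma scheduler_time_le n : (scheduler_time n <= 100 * n.+1 ^ 4)%N.
Proof.
rewrite /scheduler_time /rows_time /nvars !expnS expn0.
have h2 : (0 <= n * n)%N by [].
have h3 : (0 <= n * n * n)%N by [].
have h4 : (0 <= n * n * n * n)%N by [].
by nia.
Qed.

Theorem theorem5 (R : realType) :
  exists (prog : cmd) (a k : nat),
    forall (n m : nat) (I : instance R n m) (r mu : R) (slv : solver R n),
      (n <= m)%N -> valid_instance I -> 1 <= r ->
      exact_solver (energy I) slv ->
      min_makespan I r mu ->
      exists (T : nat) (s : store R) (S : schedule R n m),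
        [/\ exec (energy I) slv prog (input I r) T s,
            (T <= a * n.+1 ^ k)%N,
            output s S,
            feasible I S &
            makespan S <= 2 * (r + 1) / 3 * mu].
Proof.
exists scheduler, 100%N, 4%N => n m I r mu slv le_nm valid_I r1 exact_slv min_mu.
suff [T [s [ex leT [S [outS feasS spanS]]]]] :
    runs (energy I) slv scheduler (input I r) (scheduler_time n) (fun s =>
      exists S : schedule R n m,
        [/\ output s S, feasible I S & makespan S <= 2 * (r + 1) / 3 * mu]).
  exists T, s, S; split=> //; exact: leq_trans leT (scheduler_time_le n).
pose adj := nmem (input I r) 2; pose del := rmem (input I r) 0.
apply: runs_seq (_ : runs _ _ _ _ _ _) _.
  by apply: (@runs_layout _ _ _ _ adj del (budget I) r).
move=> s [env_s lay_s o5 l6 h8].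
apply: runs_seq (_ : runs _ _ _ _ _ _) _.
  by apply: (runs_header _ _ env_s lay_s) => [i|k i]; rewrite ?o5 ?l6.
clear s env_s lay_s o5 l6 h8; move=> s [env_s lay_s hd_s B_s].
apply: runs_seq (_ : runs _ _ _ _ _ _) _; first exact: runs_rows env_s lay_s hd_s B_s.
clear s env_s lay_s hd_s B_s; move=> s [C B].
have [env_s [base _ _] _ _] := C; have [n_s _ _ _ _] := env_s.
have [Pcvx feasE valE wgtE] := query_relaxation (energy I) C B.
set P := query _ _ _ _ _ _ _ _ _ in Pcvx feasE valE wgtE.
have [attained [x0 [fx0 vx0]]] :=
  relaxation_optimum valid_I r1 (erefl : cp_nv P = nvars n) Pcvx feasE valE wgtE le_nm min_mu.
have [/feasE relX optX] := exact_slv P Pcvx attained.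
(* The feasible point [x0] of value mu bounds the optimum returned by the solver. *)
have Xmu : coeffs (slv P) (n + n)%N <= mu by rewrite -valE -vx0; exact: optX.
set X := coeffs (slv P) in relX Xmu.
have rctx_s : rctx n adj del (budget I) r X (put_col s 9 (slv P)).
  split=> // i lin; rewrite /= /X /coeffs.
  by case: insubP => //; rewrite lin.
apply: runs_seq (_ : runs _ _ _ _ _ (fun t => t = put_col s 9 (slv P))) _.
  apply: runs_solve (_ : _ = nvars n) _ _; [|by case: B => -[_ h] _ _ _ _; exact: h|by []].
  by rewrite /= n_s base// /nvars; lia.
move=> _ ->.
apply: runs_seq (_ : runs _ _ _ _ _ _) _; first exact: runs_round rctx_s.
move=> {}s' [rctx' rnd pr].
pose loc := [rel i j : 'I_n | local_edge n adj X i j].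
(* This carries [chained loc] over to natural indices. It is vacuous outside the tasks, so
   transitivity needs the middle index below n. *)
pose cmp k l := forall i j : 'I_n, i = k :> nat -> j = l :> nat -> chained loc i j.
have loc_inj i j k : loc i k -> loc j k -> i = j.
  exact (@local_edge_inj _ _ _ _ _ _ relX i j k).
have loc_fun i j k : loc i j -> loc i k -> j = k.
  exact (@local_edge_fun _ _ _ _ _ _ relX i j k).
apply: runs_weaken (leqnn _) _.
  apply: (@runs_merge _ _ _ _ adj del (budget I) r X s' cmp) => //.
  - move=> k i j ik jk; have -> : i = j by apply: val_inj; rewrite /= ik jk.
    by rewrite /chained /= connect0.
  - by move=> k l _ _ kl i j il jk; rewrite chained_sym; exact: kl.
  - move=> k l p _ ln _ kl lp i j ik jp.
    exact: chained_trans loc_inj loc_fun _ _ _ (kl i (Ordinal ln) ik erefl)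
      (lp (Ordinal ln) j erefl jp).
  - move=> k l _ _ + i j ik jl; rewrite -ik -jl => ij.
    by apply/orP; left; apply: (@connect1 _ loc); exact: ij.
move=> t [rnd_t [plt plab] ploc].
pose S := Schedule (fun j : 'I_n => rmem t 3 j 0) (fun j : 'I_n => rmem t 4 j 0)
  (fun j : 'I_n => widen_ord le_nm (Ordinal (plt j (ltn_ord j)))).
have [] := rounding_feasible valid_I r1 relX (S := S).
- by move=> j; have [] := rnd_t j (ltn_ord j).
- by move=> j; have [] := rnd_t j (ltn_ord j).
- by move=> i j ij; apply: val_inj; exact: ploc.
- by move=> i j /(congr1 val) ij; exact: (plab i j (ltn_ord i) (ltn_ord j) ij).
move=> feasS spanS; exists S; split=> //.
apply: le_trans spanS _; apply: ler_wpM2l Xmu; lra.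
Qed.
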